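(* Let $F\hookrightarrow M\rightarrow S^1$ be a surface bundle over $S^1$, and let $\varphi:\widetilde M\to M$ be an $n$-fold covering space with $\widetilde M$ connected. Then there are a divisor $m$ of $n$, a surface bundle $N$ over $S^1$, and covering spaces of surface bundles over $S^1$ $$\varphi_\gamma:\widetilde M\to N,\qquad \varphi_q:N\to M,\qquad \varphi=\varphi_q\circ\varphi_\gamma,$$ such that $\varphi_q$ is $m$-fold and $\varphi_\gamma$ is $n/m$-fold, $\varphi_q^{-1}(F)=F_1\sqcup\cdots\sqcup F_m$ with $\varphi_q|:F_i\rightarrow F$ a homeomorphism for $i=1,\dots,m$, and $\varphi_\gamma^{-1}(\widetilde F)$ is connected for $\widetilde F$ any fiber of $N$.
   Context: A surface bundle $F\hookrightarrow M\to S^1$ has connected fiber a surface $F$ and is of the form $M=\frac{F\times I}{(x,0)\sim(h(x),1)}$ for a homeomorphism $h:F\to F$, its monodromy; here $F$ also denotes a fiber of $M$. The integer $n\ge 1$ is finite. The coverings $\varphi_\gamma$ and $\varphi_q$ are allowed to be homeomorphisms. *)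

(* Defs.v *)
From HB Require Import structures.
From Stdlib Require Import Relation_Operators.
From mathcomp Require Import all_boot all_order all_algebra generic_quotient.
From mathcomp Require Import all_classical all_reals all_analysis.
Set Implicit Arguments.
Unset Strict Implicit.
Unset Printing Implicit Defensive.
Import Order.TTheory GRing.Theory Num.Theory.
Import numFieldNormedType.Exports.
Local Open Scope classical_set_scope.
Local Open Scope ring_scope.
Local Open Scope quotient_scope.
Local Open Scope card_scope.

(* A set used as a type is [set_type], with the topology initial for
   [set_val]; this is how subspaces are treated throughout. *)

Definition homeomorphism (X Y : topologicalType) (f : X -> Y) : Prop :=
  continuous f /\
  exists g : Y -> X, [/\ continuous g, cancel f g & cancel g f].

(* f maps A into B and the restricted map between the subspaces A and B is a
   homeomorphism. *)
Definition restricts_to_homeo (X Y : topologicalType) (f : X -> Y)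
    (A : set X) (B : set Y) : Prop :=
  exists e : A -> B,
    homeomorphism e /\ forall a : A, set_val (e a) = f (set_val a).

Definition evenly_covered (X Y : topologicalType) (f : X -> Y) (U : set Y) :
    Prop :=
  exists S : set (set X),
    [/\ trivIset S id,
        f @^-1` U = \bigcup_(V in S) V &
        forall V, S V -> open V /\ restricts_to_homeo f V U].

Definition covering (X Y : topologicalType) (f : X -> Y) : Prop :=
  continuous f /\
  forall y : Y, exists U : set Y, open_nbhs y U /\ evenly_covered f U.

Definition fold_covering (n : nat) (X Y : topologicalType) (f : X -> Y) :
    Prop :=
  covering f /\ forall y : Y, f @^-1` [set y] #= `I_n.

Definition half_plane (R : realType) : set (R * R) := [set z | 0 <= z.2].
Arguments half_plane : clear implicits.

(* Neither compactness nor empty boundary is required. *)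
Definition surface (R : realType) (F : topologicalType) : Prop :=
  [/\ hausdorff_space F, @second_countable F &
      forall x : F, exists (U : set F) (A : set (half_plane R)) (e : U -> A),
        [/\ open_nbhs x U, open A & homeomorphism e]].

Definition unit_interval (R : realType) : set R := `[0, 1].
Arguments unit_interval : clear implicits.

Definition circle (R : realType) : set (R * R) :=
  [set z | z.1 ^+ 2 + z.2 ^+ 2 = 1].
Arguments circle : clear implicits.

Section MappingTorus.
Variables (R : realType) (F : topologicalType) (h : F -> F).

Definition torus_glue (a b : F * unit_interval R) : Prop :=
  [/\ set_val a.2 = 0, set_val b.2 = 1 & b.1 = h a.1].

Definition torus_eq (a b : F * unit_interval R) : bool :=
  `[< clos_refl_sym_trans _ torus_glue a b >].

Lemma torus_eq_refl : reflexive torus_eq.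
Proof. by move=> a; apply/asboolP; exact: rst_refl. Qed.

Lemma torus_eq_sym : symmetric torus_eq.
Proof.
by move=> a b; apply/idP/idP => /asboolP ab; apply/asboolP; exact: rst_sym.
Qed.

Lemma torus_eq_trans : transitive torus_eq.
Proof.
move=> b a c /asboolP ab /asboolP bc; apply/asboolP.
exact: rst_trans ab bc.
Qed.

Definition torus_rel := EquivRel _ torus_eq_refl torus_eq_sym torus_eq_trans.

Definition mapping_torus := {eq_quot torus_rel}.

HB.instance Definition _ :=
  Topological.copy mapping_torus (quotient_topology mapping_torus).
HB.instance Definition _ := Quotient.on mapping_torus.

Definition torus_class (x : F) (t : unit_interval R) : mapping_torus :=
  \pi_mapping_torus (x, t).

End MappingTorus.

(* The projection of the mapping torus is the class of (x, t) |-> exp(2 pi i t), with the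
   circle sitting in R * R. *)
Definition surface_bundle (R : realType) (F M : topologicalType)
    (p : M -> circle R) : Prop :=
  [/\ surface R F,
      [set: F] !=set0,
      connected [set: F] &
      exists h : F -> F, homeomorphism h /\
        exists Phi : mapping_torus R h -> M, homeomorphism Phi /\
          forall (x : F) (t : unit_interval R),
            set_val (p (Phi (torus_class h x t))) =
            (cos (2 * pi * set_val t), sin (2 * pi * set_val t))].

Definition fiber (R : realType) (M : topologicalType) (p : M -> circle R)
  (z : circle R) : set M := p @^-1` [set z].

(* An n-fold covering of total spaces carrying fibers into fibers. *)
Definition bundle_covering (R : realType) (n : nat) (M M' : topologicalType)
    (p : M -> circle R) (p' : M' -> circle R) (f : M -> M') : Prop :=
  fold_covering n f /\
  exists b : circle R -> circle R,
    continuous b /\ forall x : M, p' (f x) = b (p x).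

(* A is the topological disjoint union of the family P. *)
Definition disjoint_union (X : topologicalType) (I : Type) (P : I -> set X)
    (A : set X) : Prop :=
  [/\ trivIset setT P,
      \bigcup_i P i = A &
      forall i, exists O : set X, open O /\ P i = A `&` O].

(* Main.v *)
(** A surface bundle over the circle is the same thing as a space [M] with a map
    [p] to the circle and a flow [psi] with [p (psi_s x) = e^(2 pi i s) p x]: the
    suspension flow in one direction, the return map on the fiber over [1]
    in the other. Flows lift to the covering space by homotopy lifting, so
    [p o phi] is equivariant on [Mt]. Let [A] be a minimal nonempty clopen part
    of its fiber over [1] (it exists because the fiber covers the connected
    surface [F] finitely many times), and let [m > 0] be least such that the
    time-[m] map preserves [A]. Since [Mt] is connected, every point is
    [psi_s a] with [a] in [A], and [pt (psi_s a) = e^(2 pi i s / m)] is a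
    well-defined continuous [m]-th root of [p o phi] with connected fibers.
    Take [N = {(x, z) | p x = z^m}], with [phi_q] the first projection, [pN] the
    second and [phi_g y = (phi y, pt y)]. *)
Require Import Defs.
From HB Require Import structures.
From Stdlib Require Import Relation_Operators.
From mathcomp Require Import all_boot all_order all_algebra generic_quotient.
From mathcomp Require Import all_classical all_reals all_analysis.
From mathcomp Require Import ring lra zify.
Set Implicit Arguments.
Unset Strict Implicit.
Unset Printing Implicit Defensive.
Import Order.TTheory GRing.Theory Num.Theory.
Import numFieldNormedType.Exports.
Local Open Scope classical_set_scope.
Local Open Scope ring_scope.

(** * Subspaces and continuity *)

(** Flows spare the construction of monodromies by hand: a flow lifts through a covering, and its
    return map is read off afterwards. The price is the continuity of the suspension flow on a
    quotient times R, where local compactness of R enters. Finiteness of [phi] is spent twice. Only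
    finitely many points of the fiber of [Mt] lie over one point of [F], so its clopen parts can be
    compared by counting; and among the translates of [A] two must meet, so a positive return time
    exists. The return times of [A] are exactly the multiples of [m], hence the time [s] at which a
    point is reached from [A] is determined modulo [m], which is what e^(2 pi i s / m) requires.
    With [N] a fiber product, the factorization of [phi] holds by computation, [phi_q] is [m]-fold
    because a point of the circle has [m] roots, and [N] again carries a flow. That [phi_g] is a
    covering follows from cancellation: [phi] and [phi_q] are coverings. Its degree is constant
    because [N] is connected, and counting one fiber gives the value [n / m]. *)

Definition insub_set (X : Type) (A : set X) (x : X) (Ax : A x) : A :=
  SigSub (mem_set Ax).

Lemma set_val_insub (X : Type) (A : set X) (x : X) (Ax : A x) :
  set_val (insub_set Ax) = x.
Proof. by []. Qed.

Lemma set_val_in (X : Type) (A : set X) (x : A) : A (set_val x).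
Proof. exact: set_valP. Qed.

Lemma set_val_inj (X : Type) (A : set X) : injective (@set_val X A).
Proof. exact: val_inj. Qed.

Lemma set_val_continuous (X : topologicalType) (A : set X) :
  continuous (@set_val X A).
Proof. exact: initial_continuous. Qed.

Lemma continuous_set_val (X Y : topologicalType) (A : set Y) (f : X -> A)
    (x : X) : {for x, continuous (set_val \o f)} -> {for x, continuous f}.
Proof.
move=> cf U [?/= [[W oW <-]]] /= Wsfz /filterS; apply; apply: cf.
exact: open_nbhs_nbhs.
Qed.

Lemma continuous_near_open (X Y : topologicalType) (f : X -> Y) (x : X)
    (O : set Y) : {for x, continuous f} -> open O -> O (f x) ->
  \forall y \near x, O (f y).
Proof. by move=> cf oO Ofx; apply: cf; exact: open_nbhs_nbhs. Qed.

Lemma continuous_near_eq (X Y : topologicalType) (f g : X -> Y) (x : X) :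
  (\forall y \near x, f y = g y) -> {for x, continuous f} ->
  {for x, continuous g}.
Proof.
move=> fg cf; have fgx : f x = g x by exact: nbhs_singleton fg.
move=> U; rewrite /= -fgx => /cf; rewrite !nbhs_simpl /= => fU.
near=> y; rewrite /= -?(near fg) //; near: y.
Unshelve. all: by end_near. Qed.

Lemma continuous_pair (X Y Z : topologicalType) (f : X -> Y) (g : X -> Z)
    (x : X) : {for x, continuous f} -> {for x, continuous g} ->
  {for x, continuous (fun y => (f y, g y))}.
Proof. by move=> cf cg; apply: cvg_pair. Qed.

Lemma continuous_comp2 (X Y Z W : topologicalType) (f : Y -> Z -> W)
    (a : X -> Y) (b : X -> Z) (x : X) :
  continuous (fun z : Y * Z => f z.1 z.2) -> {for x, continuous a} ->
  {for x, continuous b} -> {for x, continuous (fun y => f (a y) (b y))}.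
Proof.
move=> cf ca cb.
apply: (@continuous_comp _ _ _ (fun y => (a y, b y)) (fun z => f z.1 z.2)).
  exact: continuous_pair.
exact: cf.
Qed.

Lemma near_all (X : topologicalType) (Q : X -> Prop) (x : X) :
  (forall y, Q y) -> \forall y \near x, Q y.
Proof. exact: nearW. Qed.

Lemma near_forall (X : topologicalType) (I : finType) (Q : I -> X -> Prop)
    (x : X) : (forall i, \forall y \near x, Q i y) ->
  \forall y \near x, forall i, Q i y.
Proof. by move=> h; apply: filter_forall. Qed.

Lemma connected_clopen_setT (X : topologicalType) (B : set X) :
  connected [set: X] -> open B -> closed B -> B !=set0 -> B = setT.
Proof. by move=> cX oB cB B0; apply: cX => //; exists B; rewrite // setTI. Qed.

(** The working form of connectedness: constancy of degrees, extension of lifts in time and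
    reachability under a flow are all phrased as locally constant predicates. *)
Lemma connected_locally_constant (X : topologicalType) (K : X -> Prop) (x y : X) :
  connected [set: X] -> (forall z, \forall z' \near z, K z' <-> K z) ->
  K x -> K y.
Proof.
move=> cX loc Kx; suff KT : [set z | K z] = setT.
  by have : [set: X] y by []; rewrite -KT.
apply: connected_clopen_setT => //; last by exists x.
  by rewrite openE => z Kz; have := loc z; apply: filterS => z' [_]; exact.
by rewrite -openC openE => z Kz; have := loc z; apply: filterS => z' [h _] /h.
Qed.

Lemma continuous_open_preimage (X Y : topologicalType) (f : X -> Y)
    (U : set X) (V : set Y) : open U -> open V ->
  (forall x, U x -> {for x, continuous f}) -> open (U `&` f @^-1` V).
Proof.
move=> oU oV cf; rewrite openE => x [Ux Vfx].
apply: filterI; first exact: open_nbhs_nbhs.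
by apply: cf => //; exact: open_nbhs_nbhs.
Qed.

(** * The circle *)

Section Circle.
Variable R : realType.
Implicit Types (s t u : R) (z : circle R).

Lemma continuous_linear_comb (T : topologicalType) (f g : T -> R) (a b : R) :
  continuous f -> continuous g -> continuous (fun x => f x * a + g x * b).
Proof.
move=> cf cg x; apply: cvgD.
  by apply: cvgM; [exact: cf|exact: cvg_cst].
by apply: cvgM; [exact: cg|exact: cvg_cst].
Qed.

Lemma circle_cos_sin t : circle R (cos (2 * pi * t), sin (2 * pi * t)).
Proof. by rewrite /circle /= cos2Dsin2. Qed.

(** The universal covering of the circle. Points of the circle are handled through their real
    angles, which replaces multiplication of complex numbers by addition. *)
Definition expc t : circle R := insub_set (circle_cos_sin t).

Lemma expc_continuous : continuous expc.
Proof.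
move=> t; apply: continuous_set_val.
have c2 : {for t, continuous (fun t : R => 2 * pi * t)}.
  by move=> ?; apply: mulrl_continuous.
apply: continuous_pair.
  exact: (continuous_comp c2 (@continuous_cos R _)).
exact: (continuous_comp c2 (@continuous_sin R _)).
Qed.

Lemma cosD_int t (k : int) : cos (2 * pi * (t + k%:~R)) = cos (2 * pi * t).
Proof.
have H (n : nat) s : cos (2 * pi * (s + n%:R)) = cos (2 * pi * s).
  rewrite mulrDr -[2 * pi * n%:R](_ : pi *+ 2 *+ n = _); last first.
    by rewrite -mulr_natr [pi *+ 2]mulr2n; ring.
  exact: (periodicn (@cosD2pi R)).
case: k => n; first exact: H.
rewrite -[in RHS](@subrK _ (n.+1%:R) t) H; congr (cos (_ * _)).
Qed.

Lemma sinD_int t (k : int) : sin (2 * pi * (t + k%:~R)) = sin (2 * pi * t).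
Proof.
have H (n : nat) s : sin (2 * pi * (s + n%:R)) = sin (2 * pi * s).
  rewrite mulrDr -[2 * pi * n%:R](_ : pi *+ 2 *+ n = _); last first.
    by rewrite -mulr_natr [pi *+ 2]mulr2n; ring.
  exact: (periodicn (@sinD2pi R)).
case: k => n; first exact: H.
rewrite -[in RHS](@subrK _ (n.+1%:R) t) H; congr (sin (_ * _)).
Qed.

Lemma expcD_int t (k : int) : expc (t + k%:~R) = expc t.
Proof. by apply: set_val_inj; rewrite !set_val_insub cosD_int sinD_int. Qed.

Lemma expc_eqP s t : expc s = expc t <-> exists k : int, s = t + k%:~R.
Proof.
split=> [|[k ->]]; last exact: expcD_int.
move=> /(congr1 (fun z => set_val z)); rewrite !set_val_insub => -[cst sst].
have pi0 := @pi_gt0 R.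
have cos1 : cos (2 * pi * (s - t)) = 1.
  by rewrite mulrBr cosB cst sst -!expr2 cos2Dsin2.
set d := s - t in cos1; exists (Num.floor d).
have fl : d = (d - (Num.floor d)%:~R) + (Num.floor d)%:~R by rewrite subrK.
set f := d - _ in fl.
have cf : cos (2 * pi * f) = 1 by rewrite -(cosD_int f (Num.floor d)) -fl.
have f0 : 0 <= f by rewrite subr_ge0 ge_floor.
have f1 : f < 1 by rewrite ltrBlDr addrC -intrD1 floorD1_gt.
suff f00 : f = 0 by move: fl; rewrite f00 /d add0r => <-; ring.
(* Cosine is injective only on [[0, pi]]: for [f] up to one half this applies directly, and beyond
   it the reflected angle [1 - f] has the same cosine. *)
have [fh|fh] := leP f (1 / 2).
  have : 2 * pi * f = 0.
    apply: (@cos_inj R); rewrite ?cos0 //; rewrite in_itv /=; last by nra.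
    by apply/andP; split; nra.
  by move=> /eqP; rewrite !mulf_eq0; nra.
have : 2 * pi * (1 - f) = 0.
  apply: (@cos_inj R); rewrite ?in_itv /= ?cos0.
  - by apply/andP; split; nra.
  - by nra.
  - by rewrite addrC (cosD_int (- f) 1) mulrN cosN.
by nra.
Qed.

Lemma expc_surj z : exists t, z = expc t.
Proof.
case: z => -[a b] abP.
have ab : a ^+ 2 + b ^+ 2 = 1 by move: abP; rewrite inE.
have a1 : -1 <= a <= 1 by apply/andP; split; nra.
have pi0 := @pi_gt0 R.
have H (s : R) : 2 * pi * (s / (2 * pi)) = s.
  by rewrite mulrC divfK // gt_eqF // mulr_gt0.
have sb : sin (acos a) = `|b|.
  by rewrite sin_acos // -ab [_ + b ^+ 2]addrC addrK sqrtr_sqr.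
have [b0|b0] := leP 0 b.
  exists (acos a / (2 * pi)); apply: set_val_inj; rewrite set_val_insub /=.
  by rewrite set_valE /= H acosK ?in_itv //= sb ger0_norm.
exists (- acos a / (2 * pi)); apply: set_val_inj; rewrite set_val_insub /=.
rewrite set_valE /= H cosN sinN acosK ?in_itv //= sb ltr0_norm //.
by rewrite opprK.
Qed.

Lemma expc_local_section t0 : exists (O : set (circle R)) (th : circle R -> R),
  [/\ open_nbhs (expc t0) O, th (expc t0) = t0,
      forall z, O z -> {for z, continuous th} &
      forall z, O z -> expc (th z) = z].
Proof.
have pi0 := @pi_gt0 R.
pose c0 := cos (2 * pi * t0); pose s0 := sin (2 * pi * t0).
have cs0 : c0 ^+ 2 + s0 ^+ 2 = 1 by rewrite cos2Dsin2.
(* [x] and [y] are the coordinates of [z] turned back by the angle [t0]; on the half circle [0 < x]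
   the remaining angle is the arcsine of [y]. *)
pose x z := (set_val z).1 * c0 + (set_val z).2 * s0.
pose y z := (set_val z).2 * c0 - (set_val z).1 * s0.
have c1 : continuous (fun z => (set_val z).1).
  move=> z; apply: continuous_comp; first exact: set_val_continuous.
  exact: cvg_fst.
have c2 : continuous (fun z => (set_val z).2).
  move=> z; apply: continuous_comp; first exact: set_val_continuous.
  exact: cvg_snd.
have cx : continuous x.
  exact: continuous_linear_comb.
have cy : continuous y.
  rewrite /y; under eq_fun do rewrite -mulrN; exact: continuous_linear_comb.
have xy z : x z ^+ 2 + y z ^+ 2 = 1.
  have := set_val_in z; rewrite /x /y; case: (set_val z) => a b /= zz.
  have {}zz : a ^+ 2 + b ^+ 2 = 1 by [].
  by rewrite -[RHS]mulr1 -{1}zz -cs0; ring.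
exists [set z | 0 < x z], (fun z => t0 + asin (y z) / (2 * pi)); split.
- split; last by rewrite /= /x set_val_insub /= -!expr2 cs0.
  have /continuousP/(_ [set r | 0 < r]) := cx.
  by apply; exact: open_gt.
- have -> : y (expc t0) = 0.
    by rewrite /y set_val_insub /= -/c0 -/s0 [s0 * c0]mulrC subrr.
  suff -> : asin 0 = 0 :> R by rewrite mul0r addr0.
  by rewrite -[in LHS]sin0 sinK // in_itv /=; apply/andP; split; nra.
- move=> z xz.
  suff cg : {for y z, continuous (fun r : R => t0 + asin r / (2 * pi))}.
    exact: (continuous_comp (cy z) cg).
  apply: cvgD; first exact: cvg_cst.
  apply: cvgM; last exact: cvg_cst.
  by apply: continuous_asin; have := xy z; move: xz => /= *; apply/andP; split; nra.
- move=> z /= xz; apply: set_val_inj; rewrite set_val_insub /=.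
  have -> : 2 * pi * (t0 + asin (y z) / (2 * pi)) = 2 * pi * t0 + asin (y z).
    by rewrite mulrDr [_ * (_ / _)]mulrC divfK // gt_eqF // mulr_gt0.
  have y1 : -1 <= y z <= 1 by have := xy z => *; apply/andP; split; nra.
  rewrite cosD sinD asinK ?in_itv //= cos_asin // -/c0 -/s0.
  rewrite -(xy z) addrK sqrtr_sqr ger0_norm ?ltW // /x /y.
  case: (set_val z) => a b /=; congr pair.
    by rewrite -[RHS]mulr1 -cs0; ring.
  by rewrite -[RHS]mulr1 -cs0; ring.
Qed.

End Circle.

(** * Finite coverings *)

Section PartialHomeo.
Variables X Z : topologicalType.
Implicit Types (U : set X) (A : set Z) (E : X -> Z) (G : Z -> X).

(** A homeomorphism of [U] onto [A] carried by total maps, so that charts and sections compose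
    without passing through subtypes. *)
Definition partial_homeo U A E G : Prop :=
  [/\ forall x, U x -> A (E x) /\ G (E x) = x,
      forall a, A a -> U (G a) /\ E (G a) = a,
      forall x, U x -> {for x, continuous E} &
      forall a, A a -> {for a, continuous G}].

Lemma partial_homeo_sub U A E G : partial_homeo U A E G ->
  exists e : U -> A,
    homeomorphism e /\ forall u : U, set_val (e u) = E (set_val u).
Proof.
case=> UA AU cE cG.
pose e (u : U) : A := insub_set (UA _ (set_val_in u)).1.
pose g (a : A) : U := insub_set (AU _ (set_val_in a)).1.
exists e; split=> //; split.
  move=> u; apply: continuous_set_val.
  exact: (continuous_comp (@set_val_continuous _ _ u) (cE _ (set_val_in u))).
exists g; split.
- move=> a; apply: continuous_set_val.
  exact: (continuous_comp (@set_val_continuous _ _ a) (cG _ (set_val_in a))).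
- by move=> u; apply: set_val_inj; exact: (UA _ (set_val_in u)).2.
- by move=> a; apply: set_val_inj; exact: (AU _ (set_val_in a)).2.
Qed.

End PartialHomeo.

(** Since [U] is open, continuity on the subspace is continuity at its points in [X]; off [U] the
    extension takes the junk value [y0]. *)
Lemma open_extend (X Y : topologicalType) (U : set X) (y0 : Y) (f : U -> Y) :
  open U -> continuous f ->
  exists F : X -> Y, (forall u : U, F (set_val u) = f u) /\
    forall x, U x -> {for x, continuous F}.
Proof.
move=> oU cf.
pose F x := if pselect (U x) is left Ux then f (insub_set Ux) else y0.
have FE (u : U) : F (set_val u) = f u.
  rewrite /F; case: pselect => [Ux|/(_ (set_val_in u))//].
  by congr f; apply: set_val_inj.
exists F; split=> // x Ux W WFx.
have := cf (insub_set Ux) W; rewrite -FE set_val_insub => /(_ WFx).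
case=> O /= [[V oV <-] /= Vx VW].
apply: (filterS (P := V `&` U)).
  move=> y [Vy Uy]; have := VW (insub_set Uy); rewrite /= -FE; exact.
by apply: filterI; apply: open_nbhs_nbhs.
Qed.

Lemma homeo_partial (X Z : topologicalType) (U : set X) (A : set Z)
    (e : U -> A) : open U -> open A -> U !=set0 -> homeomorphism e ->
  exists (E : X -> Z) (G : Z -> X),
    partial_homeo U A E G /\ forall u : U, E (set_val u) = set_val (e u).
Proof.
move=> oU oA [x0 Ux0] [ce [g [cg eK gK]]].
have [E [EE cE]] := @open_extend X Z U (set_val (e (insub_set Ux0)))
  (set_val \o e) oU (fun x => continuous_comp (ce x)
    (@set_val_continuous _ _ _)).
have [G [GE cG]] := @open_extend Z X A x0
  (set_val \o g) oA (fun x => continuous_comp (cg x)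
    (@set_val_continuous _ _ _)).
exists E, G; split=> //; split=> // x Hx.
  rewrite (EE (insub_set Hx)) /= GE /= eK; split=> //; exact: set_val_in.
rewrite (GE (insub_set Hx)) /= EE /= gK; split=> //; exact: set_val_in.
Qed.

(* The sections [s i] are total functions; their values outside [U] are junk. *)
Definition trivialized (X Y : topologicalType) (f : X -> Y) (k : nat)
    (U : set Y) (s : 'I_k -> Y -> X) : Prop :=
  [/\ forall i y, U y -> f (s i y) = y /\ {for y, continuous (s i)},
      forall i, open [set x | U (f x) /\ s i (f x) = x],
      forall x, U (f x) -> exists i, s i (f x) = x &
      forall y i j, U y -> s i y = s j y -> i = j].

(** The number of sheets may change with the point and may be zero. In this form the notion passes
    to pullbacks and to factors without any count; [finite_cover_fold] restores a constant degree
    over a connected base. *)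
Definition finite_cover (X Y : topologicalType) (f : X -> Y) : Prop :=
  continuous f /\ forall y, exists k U (s : 'I_k -> Y -> X),
    open_nbhs y U /\ trivialized f U s.

Section Trivialized.
Variables (X Y : topologicalType) (f : X -> Y) (k : nat) (U : set Y).
Variable s : 'I_k -> Y -> X.
Hypotheses (cf : continuous f) (oU : open U) (fUs : trivialized f U s).

Lemma trivialized_sub (W : set Y) : open W -> W `<=` U -> trivialized f W s.
Proof.
case: fUs => [fs so sc si] oW WU; split.
- by move=> i y /WU; exact: fs.
- move=> i; rewrite (_ : [set _ | _] =
    [set x | U (f x) /\ s i (f x) = x] `&` f @^-1` W).
    by apply: openI => //; move/continuousP: cf; exact.
  by apply/seteqP; split=> x /= => [[/[dup] /WU]|[[]]].
- by move=> x /WU; exact: sc.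
- by move=> y i j /WU; exact: si.
Qed.

Lemma trivialized_sheet_homeo i :
  partial_homeo [set x | U (f x) /\ s i (f x) = x] U f (s i).
Proof.
case: fUs => [fs so sc si]; split.
- by move=> x [].
- by move=> y Uy /=; rewrite (fs i y Uy).1.
- by move=> x _; exact: cf.
- by move=> y Uy; exact: (fs i y Uy).2.
Qed.

Lemma trivialized_fiber y : U y -> (f @^-1` [set y] #= `I_k)%card.
Proof.
case: fUs => [fs so sc si] Uy.
rewrite (_ : f @^-1` [set y] = [set s i y | i in [set: 'I_k]]).
  apply: card_eq_trans; last by rewrite card_eq_sym; exact: card_II.
  by apply: inj_card_eq => i j _ _; exact: si.
apply/seteqP; split=> [x /= fx|_ [i _ <-]]; last exact: (fs i y Uy).1.
by have [|i si_x] := sc x; [rewrite fx|exists i; rewrite -?fx].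
Qed.

End Trivialized.

Lemma card_ordP (X : Type) (A : set X) (k : nat) : (A #= `I_k)%card ->
  exists g : 'I_k -> X, injective g /\ range g = A.
Proof.
rewrite card_eq_sym => kA.
have : ([set: 'I_k] #= A)%card.
  by apply: card_eq_trans kA; rewrite card_eq_sym; exact: card_II.
case/card_bijP => h [h' hK h'K].
pose v (i : 'I_k) : [set: 'I_k] := insub_set (A := [set: 'I_k]) (x := i) Logic.I.
exists (fun i => set_val (h (v i))); split.
  by move=> i j /set_val_inj /(can_inj hK) /(congr1 (fun z => set_val z)).
apply/seteqP; split=> [_ [i _ <-]|x Ax]; first exact: set_val_in.
exists (set_val (h' (insub_set Ax))) => //.
by rewrite (_ : v _ = h' (insub_set Ax)) ?h'K //; apply: set_val_inj.
Qed.

(** Each sheet over [U] meets the fiber over [y] in exactly one point, so the sheets can be indexed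
    by the [n] points of that fiber. *)
Lemma fold_covering_trivialized (n : nat) (X Y : topologicalType) (f : X -> Y) :
  fold_covering n f -> continuous f /\
  forall y, exists U (s : 'I_n -> Y -> X), open_nbhs y U /\ trivialized f U s.
Proof.
case=> -[cf ec] fn; split=> // y.
have [U [[oU Uy] [S [tS fU SV]]]] := ec y.
have [g [gi gr]] := card_ordP (fn y).
have fg i : f (g i) = y.
  by have : range g (g i) by [exists i]; rewrite gr.
have secP i : exists (V : set X) (s : Y -> X),
    [/\ S V, V (g i) & partial_homeo V U f s].
  have : (\bigcup_(V in S) V) (g i) by rewrite -fU /= fg.
  case=> V SV0 Vg; have [oV [e [he ee]]] := SV V SV0.
  have [|E [G [[VU UV cE cG] EE]]] := homeo_partial oV oU _ he.
    by exists (g i).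
  have Ef x : V x -> E x = f x.
    by move=> Vx; have := EE (insub_set Vx); rewrite ee.
  exists V, G; split=> //; split=> //.
  - by move=> x Vx; rewrite -Ef //; exact: VU.
  - by move=> a Ua; have [VG EG] := UV a Ua; rewrite -Ef.
  - by move=> x _; exact: cf.
have [V /choice[s Vs]] := choice secP.
have sheetE i : [set x | U (f x) /\ s i (f x) = x] = V i.
  have [SVi Vgi [VU UV _ _]] := Vs i; apply/seteqP; split=> x /=.
    by case=> Ux <-; exact: (UV _ Ux).1.
  exact: VU.
exists U, s; split=> //; split.
- move=> i z Uz; have [SVi Vgi [VU UV _ cs]] := Vs i.
  by split; [exact: (UV z Uz).2|exact: cs].
- by move=> i; rewrite sheetE; have [SVi _ _] := Vs i; exact: (SV _ SVi).1.
- move=> x Ux; have : (\bigcup_(V in S) V) x by rewrite -fU.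
  case=> W SW Wx; have [oW [e [he ee]]] := SV W SW.
  have [|E [G [[WU UW _ _] EE]]] := homeo_partial oW oU _ he; first by exists x.
  have Ef x' : W x' -> E x' = f x'.
    by move=> Wx'; have := EE (insub_set Wx'); rewrite ee.
  have [WG EG] := UW y Uy.
  have : range g (G y) by rewrite gr /= -Ef.
  case=> i _ gi_G; exists i; have [SVi Vgi [VU UV _ _]] := Vs i.
  have WV : W = V i.
    by apply: tS => //; exists (g i); split=> //; rewrite gi_G.
  by apply: (VU x _).2; rewrite -WV.
- move=> z i j Uz sij; have [SVi Vgi [VUi UVi _ _]] := Vs i.
  have [SVj Vgj [VUj UVj _ _]] := Vs j.
  have VV : V i = V j.
    apply: tS => //; exists (s i z); split; first exact: (UVi z Uz).1.
    by rewrite sij; exact: (UVj z Uz).1.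
  apply: gi; have Vjg : V j (g i) by rewrite -VV.
  have [_] := VUj _ Vjg; have [_] := VUj _ Vgj; rewrite !fg.
  by move=> -> ->.
Qed.

Lemma trivialized_fold_covering (n : nat) (X Y : topologicalType) (f : X -> Y) :
  continuous f ->
  (forall y, exists U (s : 'I_n -> Y -> X), open_nbhs y U /\ trivialized f U s) ->
  fold_covering n f.
Proof.
move=> cf tf; split; last first.
  by move=> y; have [U [s [[oU Uy] tr]]] := tf y; exact: (trivialized_fiber tr Uy).
split=> // y; have [U [s [oUy tr]]] := tf y.
exists U; split=> //; exists [set [set x | U (f x) /\ s i (f x) = x] | i in setT].
case: (tr) => fs so sc si; split.
- move=> _ _ [i _ <-] [j _ <-] [x [[Ux six] [_ sjx]]].
  by rewrite (si (f x) i j) // six sjx.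
- apply/seteqP; split=> [x /= Ux|x [_ [i _ <-] [] //]].
  have [i six] := sc x Ux.
  by exists [set x | U (f x) /\ s i (f x) = x] => //; exists i.
- move=> _ [i _ <-]; split=> //.
  have /partial_homeo_sub[e [he ee]] := trivialized_sheet_homeo cf tr i.
  by exists e; split=> // a; rewrite ee.
Qed.

Lemma fold_covering_finite_cover (n : nat) (X Y : topologicalType)
    (f : X -> Y) : fold_covering n f -> finite_cover f.
Proof.
move=> /fold_covering_trivialized[cf tr]; split=> // y.
by have [U [s us]] := tr y; exists n, U, s.
Qed.

(** The cardinality of fibers is constant over a trivializing set, hence locally constant; the point
    [y0] fixes its value. *)
Lemma finite_cover_fold (X Y : topologicalType) (f : X -> Y) :
  Y -> connected [set: Y] -> finite_cover f -> exists k, fold_covering k f.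
Proof.
move=> y0 cY [cf tr]; have [k [U0 [s0 [[oU0 Uy0] tr0]]]] := tr y0.
exists k; apply: trivialized_fold_covering => // y.
pose K y : Prop := (f @^-1` [set y] #= `I_k)%card.
have loc z : \forall z' \near z, K z' <-> K z.
  have [k' [U [s [[oU Uz] tr1]]]] := tr z.
  have : \forall z' \near z, U z' by exact: open_nbhs_nbhs.
  apply: filterS => z' Uz'; rewrite /K /=.
  have c1 := trivialized_fiber tr1 Uz; have c2 := trivialized_fiber tr1 Uz'.
  split=> h; apply: card_eq_trans h.
    by apply: card_eq_trans c1 _; rewrite card_eq_sym.
  by apply: card_eq_trans c2 _; rewrite card_eq_sym.
have Ky : K y.
  apply: (@connected_locally_constant _ K y0 y cY loc).
  exact: (trivialized_fiber tr0 Uy0).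
have [k' [U [s [[oU Uy] tr1]]]] := tr y.
have kk : k' = k.
  apply/card_eq_II; apply: card_eq_trans Ky.
  by rewrite card_eq_sym; exact: (trivialized_fiber tr1 Uy).
by subst k'; exists U, s.
Qed.

(** The image of a clopen set is clopen: near [z] a preimage in [B] is one of finitely many points
    [s i z'], and membership of each in [B] is locally constant. *)
Lemma finite_cover_clopen_surj (X Y : topologicalType) (f : X -> Y) (B : set X)
    (y : Y) : finite_cover f -> connected [set: Y] -> open B -> closed B ->
  B !=set0 -> exists x, B x /\ f x = y.
Proof.
move=> [cf tr] cY oB cB [x0 Bx0].
pose K y := exists x, B x /\ f x = y.
suff loc z : \forall z' \near z, K z' <-> K z.
  by apply: (@connected_locally_constant _ K (f x0) y cY loc); exists x0.
have [k [U [s [[oU Uz] [fs so sc si]]]]] := tr z.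
have KE z' : U z' -> K z' <-> exists i, B (s i z').
  move=> Uz'; split=> [[x [Bx fx]]|[i Bi]].
    by have [|i six] := sc x; [rewrite fx|exists i; rewrite -fx six].
  by exists (s i z'); split=> //; exact: (fs i z' Uz').1.
have nU : \forall z' \near z, U z' by exact: open_nbhs_nbhs.
have nB : \forall z' \near z, forall i, B (s i z') <-> B (s i z).
  apply: filter_forall => i; have ci := (fs i z Uz).2.
  have [Bi|nBi] := pselect (B (s i z)).
    by apply: filterS (continuous_near_open ci oB Bi) => z' Bz'; split.
  by apply: filterS (continuous_near_open ci (closed_openC cB) nBi) => z' Bz'; split.
apply: filterS2 nU nB => z' Uz' Bz'; rewrite (KE z' Uz') (KE z Uz).
by split=> -[i Bi]; exists i; apply/Bz'.
Qed.

(** Base change along the embedding [j], with the pullback realized as the part [A] of [X] over the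
    image of [j]. Continuity of the inverse [r] is asked only along that image, because the
    retraction of a bundle onto one fiber has to jump elsewhere. *)
Lemma finite_cover_pullback (X Y F : topologicalType) (f : X -> Y) (j : F -> Y)
    (r : Y -> F) (A : set X) : finite_cover f -> continuous j -> cancel j r ->
  (forall x, A x <-> j (r (f x)) = f x) ->
  (forall y, j (r y) = y -> {for y, continuous r}) ->
  finite_cover (fun a : A => r (f (set_val a))).
Proof.
move=> [cf tr] cj jK AE cr.
have cf' : continuous (fun a : A => r (f (set_val a))).
  move=> a; have Aa := set_val_in a.
  have c1 := continuous_comp (@set_val_continuous _ _ a) (cf (set_val a)).
  exact: (continuous_comp c1 (cr _ ((AE _).1 Aa))).
split=> // x0; have [k [U [s [[oU Ux0] [fs so sc si]]]]] := tr (j x0).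
have As i x : U (j x) -> A (s i (j x)).
  by move=> Ux; apply/AE; rewrite (fs _ _ Ux).1 jK.
pose s' i x : A := if pselect (U (j x)) is left Ux then insub_set (As i x Ux)
  else insub_set (As i x0 Ux0).
have s'E i x : U (j x) -> set_val (s' i x) = s i (j x).
  by rewrite /s'; case: pselect.
have oU' : open (j @^-1` U) by move/continuousP: cj; exact.
have UA (a : A) : U (j (r (f (set_val a)))) <-> U (f (set_val a)).
  by rewrite ((AE _).1 (set_val_in a)).
exists k, (j @^-1` U), s'; split; first by split.
split.
- move=> i x Ux; split; first by rewrite s'E // (fs _ _ Ux).1 jK.
  apply: continuous_set_val.
  apply: (@continuous_near_eq _ _ (s i \o j)); last first.
    exact: (continuous_comp (cj x) (fs _ _ Ux).2).
  have : \forall y \near x, (j @^-1` U) y by exact: open_nbhs_nbhs.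
  by apply: filterS => y Uy; rewrite /= s'E.
- move=> i; exists [set x | U (f x) /\ s i (f x) = x] => //.
  apply/seteqP; split=> a /=; rewrite UA => -[Ua sa]; split=> //.
    by apply: set_val_inj; rewrite s'E ((AE _).1 (set_val_in a)).
  by rewrite -[in RHS]sa s'E ((AE _).1 (set_val_in a)).
- move=> a /= /UA Ua; have [i six] := sc _ Ua; exists i.
  by apply: set_val_inj; rewrite s'E ((AE _).1 (set_val_in a)).
- move=> x i i' Ux /(congr1 (fun z => set_val z)); rewrite !s'E //.
  exact: si.
Qed.

Lemma finite_cover_hausdorff (X Y : topologicalType) (f : X -> Y) :
  finite_cover f -> hausdorff_space Y -> hausdorff_space X.
Proof.
move=> [cf tr]; rewrite !open_hausdorff => hY x y xy.
have [fxy|fxy] := eqVneq (f x) (f y); last first.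
  have [[A B] /= [xA yB] [oA oB AB]] := hY _ _ fxy.
  exists (f @^-1` A, f @^-1` B) => /=.
    by move: xA yB; rewrite !inE.
  split; [by move/continuousP: cf; exact|by move/continuousP: cf; exact|].
  by rewrite -preimage_setI (eqP AB) preimage_set0.
have [k [U [s [[oU Ux] [fs so sc si]]]]] := tr (f x).
have [i six] := sc x Ux.
have [|j sjy] := sc y; first by rewrite -fxy.
exists ([set x | U (f x) /\ s i (f x) = x], [set x | U (f x) /\ s j (f x) = x]).
  by rewrite !inE /= -fxy; split; split=> //; rewrite fxy.
split=> //=; apply/eqP/seteqP; split=> // z [[Uz siz] [_ sjz]].
move: xy; rewrite -six -sjy (si (f z) i j) ?siz ?sjz //.
by rewrite -fxy eqxx.
Qed.

(** A basic set is a sheet over a trivialized basic set [b'], cut down to the preimage of a basic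
    set [b]. The sheets [sh] are chosen once for each [b'] and numbered by naturals, with empty sets
    after the last one, so only countably many sets arise. *)
Lemma finite_cover_second_countable (X Y : topologicalType) (f : X -> Y) :
  finite_cover f -> @second_countable Y -> @second_countable X.
Proof.
move=> [cf tr] [B cB [oB bB]].
have shP (b : set Y) : exists sh : nat -> set X,
    (exists k (s : 'I_k -> Y -> X), trivialized f b s) -> open b ->
    [/\ forall i, open (sh i), forall x, b (f x) -> exists i, sh i x &
      forall i x O, sh i x -> nbhs x O ->
        \forall y \near f x, forall x', sh i x' -> f x' = y -> O x'].
  have [[k [s tb]]|nb] := pselect (exists k (s : 'I_k -> Y -> X),
    trivialized f b s); last by exists (fun=> set0).
  exists (fun i => if insub i is Some i' then
    [set x | b (f x) /\ s i' (f x) = x] else set0) => _ ob.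
  case: tb => fs so sc si; split.
  - by move=> i; case: insub => [i'|]; [exact: so|exact: open0].
  - move=> x bx; have [i six] := sc x bx; exists (val i).
    by rewrite valK.
  - move=> i x O; case: insub => [i' [bx six] Ox|//].
    rewrite -six in Ox.
    have : \forall y \near f x, O (s i' y) by exact: (fs i' _ bx).2.
    by apply: filterS => y Oy x' [_ sx'] fx'; rewrite -sx' fx'.
have [sh shE] := choice shP.
exists [set f @^-1` t.1.1 `&` sh t.1.2 t.2 |
    t in [set t : set Y * set Y * nat | [/\ B t.1.1, B t.1.2 &
      exists k (s : 'I_k -> Y -> X), trivialized f t.1.2 s]]].
  apply: card_le_trans (card_image_le _ _) _.
  have : countable ((B `*` B) `*` [set: nat]).
    by apply: countableX => //; exact: countableX.
  by apply: card_le_trans; apply: subset_card_le => -[[b b'] i] /= [].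
split.
  move=> _ [[[b b'] i] /= [Bb Bb' tb'] <-]; apply: openI.
    by have /continuousP := cf; apply; exact: oB.
  by have [] := shE b' tb' (oB _ Bb').
move=> x O Ox.
have [k [U [s [oU tU]]]] := tr (f x).
have [b' [Bb' b'x] b'U] := bB (f x) U (open_nbhs_nbhs oU).
have tb' : exists k (s : 'I_k -> Y -> X), trivialized f b' s.
  by exists k, s; apply: (trivialized_sub cf tU) => //; exact: oB.
have [osh csh nsh] := shE b' tb' (oB _ Bb').
have [i shi] := csh x b'x.
have [b [Bb bx] bO] := bB (f x) _ (nsh i x O shi Ox).
exists (f @^-1` b `&` sh b' i); first by split=> //; exists (b, b', i).
by move=> x' [bx' shx']; exact: bO bx' x' shx' erefl.
Qed.

Lemma finite_cover_surface (R : realType) (X Y : topologicalType) (f : X -> Y) :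
  finite_cover f -> surface R Y -> surface R X.
Proof.
move=> fc [hY sY chY]; split.
- exact: finite_cover_hausdorff fc hY.
- exact: finite_cover_second_countable fc sY.
move=> x; case: (fc) => cf tr; have [k [U [s [[oU Ux] tU]]]] := tr (f x).
have [U1 [A [e [[oU1 U1x] oA he]]]] := chY (f x).
have [|E [G [[UA AU cE cG] _]]] := homeo_partial oU1 oA _ he; first by exists (f x).
case: (tU) => fs so sc si; have [i six] := sc x Ux.
pose V := [set x | U (f x) /\ s i (f x) = x] `&` f @^-1` U1.
pose A' := A `&` G @^-1` U.
have oA' : open A' by exact: continuous_open_preimage.
have oV : open V by apply: openI => //; move/continuousP: cf; exact.
have : partial_homeo V A' (E \o f) (s i \o G).
  split.
  - move=> x' [[Ux' six'] U1x'] /=; have [AE GE] := UA _ U1x'.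
    by split; [split=> //=|]; rewrite /= GE.
  - move=> a [Aa UGa] /=; have [UG EG] := AU _ Aa; have [fsa _] := fs i _ UGa.
    by rewrite fsa; split=> //; split=> /=; rewrite ?fsa.
  - move=> x' [[Ux' six'] U1x']; exact: (continuous_comp (cf x') (cE _ U1x')).
  - move=> a [Aa UGa]; exact: (continuous_comp (cG _ Aa) (fs i _ UGa).2).
by case/partial_homeo_sub => e' [he' _]; exists V, A', e'.
Qed.

(** * Homotopy lifting and flows *)

Lemma connectedI (R : realType) (I J : set R) :
  connected I -> connected J -> connected (I `&` J).
Proof.
move=> /connected_intervalP cI /connected_intervalP cJ.
apply/connected_intervalP => x y [Ix Jx] [Iy Jy] z xzy.
by split; [exact: cI Ix Iy z xzy|exact: cJ Jx Jy z xzy].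
Qed.

Lemma connected_setTR (R : realType) : connected [set: R].
Proof. by apply/connected_intervalP => x y _ _ z _. Qed.

(** Near [t] each lift stays on the sheet it occupies at [t], so the two agree exactly when these
    sheets coincide, a condition independent of [t']. Equality of lifts is thereby open and closed
    at once. *)
Lemma lifts_near_eq (T X Y : topologicalType) (f : X -> Y) (g1 g2 : T -> X)
    (t : T) : finite_cover f ->
  {for t, continuous g1} -> {for t, continuous g2} ->
  (\forall t' \near t, f (g1 t') = f (g2 t')) ->
  \forall t' \near t, g1 t' = g2 t' <-> g1 t = g2 t.
Proof.
move=> [cf tr] c1 c2 fg; have fgt := nbhs_singleton fg.
have [k [U [s [[oU Ut] [fs so sc si]]]]] := tr (f (g1 t)).
have [i it] := sc _ Ut; have Ut2 : U (f (g2 t)) by rewrite -fgt.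
have [j jt] := sc _ Ut2.
have n1 := continuous_near_open c1 (so i) (conj Ut it).
have n2 := continuous_near_open c2 (so j) (conj Ut2 jt).
apply: filterS3 fg n1 n2 => t' ft' [Ut' it'] [_ jt'].
split=> g12.
  have ij : i = j by apply: (si (f (g1 t'))) => //; rewrite it' ft' jt'.
  by rewrite -it -jt ij fgt.
have ij : i = j by apply: (si (f (g1 t))) => //; rewrite it fgt jt.
by rewrite -it' -jt' ij ft'.
Qed.

Lemma unique_lifting (T X Y : topologicalType) (f : X -> Y) (I : set T)
    (g1 g2 : T -> X) (t0 t : T) : finite_cover f -> open I -> connected I ->
  (forall t, I t -> {for t, continuous g1}) ->
  (forall t, I t -> {for t, continuous g2}) ->
  (forall t, I t -> f (g1 t) = f (g2 t)) ->
  I t0 -> g1 t0 = g2 t0 -> I t -> g1 t = g2 t.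
Proof.
move=> fc oI cI c1 c2 fg It0 g0.
have near_eq u : I u -> \forall v \near u, I v /\ (g1 v = g2 v <-> g1 u = g2 u).
  move=> Iu; have nI : \forall v \near u, I v by exact: open_nbhs_nbhs.
  have nf : \forall v \near u, f (g1 v) = f (g2 v) by exact: filterS fg nI.
  by apply: filterS2 nI (lifts_near_eq fc (c1 u Iu) (c2 u Iu) nf).
pose D := [set u | I u /\ g1 u = g2 u].
pose E := [set u | I u /\ g1 u <> g2 u].
have oD : open D.
  rewrite openE => u [Iu gu]; apply: filterS (near_eq u Iu) => v [Iv gv].
  by split=> //; exact/gv.
have oE : open E.
  rewrite openE => u [Iu gu]; apply: filterS (near_eq u Iu) => v [Iv gv].
  by split=> // /gv.
suff : D = I by move=> <- [].
apply: cI; first by exists t0.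
  by exists D => //; apply/seteqP; split=> u; [case|case=> _ []].
exists (~` E); first exact: open_closedC.
apply/seteqP; split=> u [Iu]; first by move=> gu; split=> // -[].
by move=> nE; split=> //; apply: contrapT => gu; exact: nE.
Qed.

Section HomotopyLifting.
Variables (R : realType) (X Y Z : topologicalType) (f : X -> Y).
Variables (H : Z * R -> Y) (g : Z -> X).
Hypotheses (fc : finite_cover f) (cH : continuous H) (cg : continuous g).
Hypothesis fg : forall z, f (g z) = H (z, 0).

(** Every time interval is open, connected and contains 0. Two local lifts over the same [z]
    therefore share a connected interval on which they start at the same point, and unique lifting
    makes them agree there. *)
Definition local_lift (z0 : Z) (W : set Z) (I : set R) (L : Z * R -> X) :=
  [/\ open_nbhs z0 W, open I /\ connected I, I 0,
      forall z t, W z -> I t -> f (L (z, t)) = H (z, t) /\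
        {for (z, t), continuous L} &
      forall z, W z -> L (z, 0) = g z].

Lemma local_lift_unique z1 z2 W1 W2 I1 I2 L1 L2 z t :
  local_lift z1 W1 I1 L1 -> local_lift z2 W2 I2 L2 ->
  W1 z -> W2 z -> I1 t -> I2 t -> L1 (z, t) = L2 (z, t).
Proof.
move=> [_ [oI1 cI1] I10 f1 g1] [_ [oI2 cI2] I20 f2 g2] W1z W2z I1t I2t.
have cz u : {for u, continuous (fun t : R => (z, t))}.
  by apply: continuous_pair; [exact: cvg_cst|exact: cvg_id].
apply: (@unique_lifting _ _ _ f (I1 `&` I2) (fun t => L1 (z, t))
  (fun t => L2 (z, t)) 0 t) => //.
- exact: openI.
- exact: connectedI.
- by move=> u [I1u I2u]; apply: (continuous_comp (cz u) (f1 z u W1z I1u).2).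
- by move=> u [I1u I2u]; apply: (continuous_comp (cz u) (f2 z u W2z I2u).2).
- by move=> u [I1u I2u]; rewrite (f1 z u W1z I1u).1 (f2 z u W2z I2u).1.
- by rewrite g1 // g2.
Qed.

Lemma open_box (z0 : Z) (b : R) (O : set (Z * R)) : open O -> O (z0, b) ->
  exists (W : set Z) (J : set R), [/\ open_nbhs z0 W, open J /\ connected J,
    J b & forall z t, W z -> J t -> O (z, t)].
Proof.
move=> oO Oz; have : nbhs (z0, b) O by exact: open_nbhs_nbhs.
case=> -[W J] /= []; rewrite nbhsE => -[W' oW' W'W] /nbhs_ballP[e /= e0 eJ] WJ.
exists W', (ball b e); split=> //.
- split; first exact: ball_open.
  by rewrite ball_itv; apply/connected_intervalP/interval_is_interval.
- exact: ballxx.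
- by move=> z t W'z et; apply: WJ; split; [exact: W'W|exact: eJ].
Qed.

(** The times reachable by a local lift around [z0] form a clopen subset of the line, so all times
    are reachable. *)
Lemma local_lift_exists z0 b : exists W I L, local_lift z0 W I L /\ I b.
Proof.
case: (fc) => cf tr.
pose K b := exists W I L, local_lift z0 W I L /\ I b.
have chart c : exists k U (s : 'I_k -> Y -> X) W J, [/\ trivialized f U s,
    open_nbhs z0 W, open J /\ connected J, J c &
    forall z t, W z -> J t -> U (H (z, t))].
  have [k [U [s [[oU Uc] tU]]]] := tr (H (z0, c)).
  have oHU : open (H @^-1` U) by move/continuousP: cH; exact.
  by have [W [J [? ? ? ?]]] := open_box oHU Uc; exists k, U, s, W, J.
have contL k U (s : 'I_k -> Y -> X) i z t : trivialized f U s ->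
    U (H (z, t)) -> {for (z, t), continuous (s i \o H)}.
  move=> [fs _ _ _] Uz.
  by apply: continuous_comp; [exact: cH|exact: (fs i _ Uz).2].
apply: (@connected_locally_constant _ K 0 b (@connected_setTR R)); last first.
  have [k [U [s [W [J [tU [oW Wz0] [oJ cJ] J0 WJ]]]]]] := chart 0.
  case: (tU) => fs so sc si.
  have Ug : U (f (g z0)) by rewrite fg; exact: WJ.
  have [i ig] := sc _ Ug.
  pose V := [set x | U (f x) /\ s i (f x) = x].
  exists (W `&` g @^-1` V), J, (s i \o H); split=> //; split=> //.
  - split; last by [].
    by apply: openI => //; move/continuousP: cg; apply; exact: so.
  - move=> z t [Wz _] Jt /=; split; last by apply: contL tU _; exact: WJ.
    by rewrite (fs i _ (WJ _ _ Wz Jt)).1.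
  - by move=> z [Wz [_ iz]] /=; rewrite -fg.
move=> c; have [k [U [s [W [J [tU [oW Wz0] [oJ cJ] Jc WJ]]]]]] := chart c.
case: (tU) => fs so sc si.
(* One extension across the interval [J] serves both directions of local constancy. *)
suff step b1 b2 : J b1 -> J b2 -> K b1 -> K b2.
  have : \forall b' \near c, J b' by exact: open_nbhs_nbhs.
  by apply: filterS => b' Jb'; split; apply: step.
move=> Jb1 Jb2 [W1 [I [L [[[oW1 W1z0] [oI cI] I0 fL gL] Ib1]]]].
have UL : U (f (L (z0, b1))) by rewrite (fL _ _ W1z0 Ib1).1; exact: WJ.
have [i iL] := sc _ UL.
pose V := [set x | U (f x) /\ s i (f x) = x].
(* Shrinking to the [z] whose lift lies on sheet [i] at time [b1] makes [L] and [s i \o H] agree at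
   [b1], hence on all of the connected overlap of [I] and [J]; [L2] glues them. *)
pose W2 := W `&` (W1 `&` (fun z => L (z, b1)) @^-1` V).
pose L2 (zt : Z * R) := if pselect (I zt.2) then L zt else s i (H zt).
have cz (z : Z) u : {for u, continuous (fun t : R => (z, t))}.
  by apply: continuous_pair; [exact: cvg_cst|exact: cvg_id].
have oW2 : open W2.
  apply: openI => //; apply: continuous_open_preimage => //; first exact: so.
  move=> z W1z; apply: (continuous_comp _ (fL z b1 W1z Ib1).2).
  by apply: continuous_pair; [exact: cvg_id|exact: cvg_cst].
have LI z t : I t -> L2 (z, t) = L (z, t) by rewrite /L2 /=; case: pselect.
have LJ z t : W2 z -> J t -> L2 (z, t) = s i (H (z, t)).
  rewrite /L2 /=; case: pselect => // It [Wz [W1z [_ iz]]] Jt.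
  apply: (@unique_lifting _ _ _ f (I `&` J) (fun t => L (z, t))
    (fun t => s i (H (z, t))) b1 t) => //.
  - exact: openI.
  - exact: connectedI.
  - by move=> u [Iu Ju]; apply: (continuous_comp (cz z u) (fL z u W1z Iu).2).
  - move=> u [Iu Ju].
    have cu := contL _ _ _ i z u tU (WJ _ _ Wz Ju).
    exact: (continuous_comp (cz z u) cu).
  - move=> u [Iu Ju]; rewrite (fL z u W1z Iu).1.
    by rewrite (fs i _ (WJ _ _ Wz Ju)).1.
  - by rewrite -(fL z b1 W1z Ib1).1 iz.
exists W2, (I `|` J), L2; split; last by right.
split.
- by split.
- by split; [exact: openU|apply: connectedU => //; exists b1].
- by left.
- move=> z t W2z; case: (W2z) => Wz [W1z _].
  have nW2 (I' : set R) : open I' -> I' t ->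
      \forall zt \near (z, t), W2 zt.1 /\ I' zt.2.
    move=> oI' I't; exists (W2, I') => //; split; exact: open_nbhs_nbhs.
  case=> [It|Jt].
    rewrite LI // (fL z t W1z It).1; split=> //.
    apply: continuous_near_eq (fL z t W1z It).2.
    by apply: filterS (nW2 _ oI It) => -[z' t'] /= [_ It']; rewrite LI.
  rewrite LJ // (fs i _ (WJ _ _ Wz Jt)).1; split=> //.
  apply: (@continuous_near_eq _ _ (s i \o H)); last first.
    by apply: contL tU _; exact: WJ.
  by apply: filterS (nW2 _ oJ Jt) => -[z' t'] /= [W2z' Jt']; rewrite LJ.
- by move=> z [Wz [W1z _]]; rewrite LI // gL.
Qed.

Lemma homotopy_lifting : exists L : Z * R -> X,
  [/\ continuous L, forall zt, f (L zt) = H zt & forall z, L (z, 0) = g z].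
Proof.
have /choice[w wP] : forall zb : Z * R, exists w : set Z * set R * (Z * R -> X),
    local_lift zb.1 w.1.1 w.1.2 w.2 /\ w.1.2 zb.2.
  move=> [z b]; have [W [I [L h]]] := local_lift_exists z b.
  by exists (W, I, L).
(* Each point uses the local lift chosen for it; by uniqueness [L] coincides, on the whole box of
   any one choice, with that single lift. *)
pose L zt := (w zt).2 zt.
have LE zb z t : (w zb).1.1 z -> (w zb).1.2 t -> L (z, t) = (w zb).2 (z, t).
  move=> Wz It; have [h1 It1] := wP (z, t); have [h2 _] := wP zb.
  by apply: (local_lift_unique h1 h2) => //; have [[]] := h1.
exists L; split.
- move=> [z t]; have [h It] := wP (z, t); case: (h) => -[oW Wz] [oI _] _ fL _.
  apply: (@continuous_near_eq _ _ (w (z, t)).2); last exact: (fL z t Wz It).2.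
  exists ((w (z, t)).1.1, (w (z, t)).1.2).
    by split; exact: open_nbhs_nbhs.
  by move=> [z' t'] [/= Wz' It']; rewrite (LE (z, t)).
- move=> [z t]; have [h It] := wP (z, t); case: (h) => -[oW Wz] _ _ fL _.
  exact: (fL z t Wz It).1.
- by move=> z; have [[[_ Wz] _ _ _ gL] _] := wP (z, 0); exact: gL.
Qed.

End HomotopyLifting.

(** * Flows over the rotation of the circle and their lifts *)

Section Flow.
Variable R : realType.

(** The suspension flow of a mapping torus seen abstractly: an action of R on [X] that covers the
    rotation of the circle at unit speed. *)
Definition suspension_flow (X : topologicalType) (p : X -> circle R)
    (psi : X -> R -> X) : Prop :=
  [/\ continuous p, continuous (fun z : X * R => psi z.1 z.2),
      forall x, psi x 0 = x,
      forall x s t, psi (psi x s) t = psi x (s + t) &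
      forall x s t, p x = expc t -> p (psi x s) = expc (t + s)].

Lemma flow_continuous (X : topologicalType) (p : X -> circle R)
    (psi : X -> R -> X) (t : R) : suspension_flow p psi -> continuous (psi^~ t).
Proof.
move=> [_ cpsi _ _ _] x.
exact: (continuous_comp2 cpsi (@cvg_id _ (nbhs x)) (@cst_continuous X R t x)).
Qed.

Lemma flow_lift (X Y : topologicalType) (f : X -> Y) (p : Y -> circle R)
    (psi : Y -> R -> Y) : finite_cover f -> suspension_flow p psi ->
  exists psi' : X -> R -> X, suspension_flow (p \o f) psi' /\
    forall x t, f (psi' x t) = psi (f x) t.
Proof.
move=> fc [cp cpsi psi0 psiD pE]; case: (fc) => cf _.
pose H (z : X * R) := psi (f z.1) z.2.
have cH : continuous H.
  move=> z; apply: (@continuous_comp _ _ _ (fun z : X * R => (f z.1, z.2))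
    (fun z : Y * R => psi z.1 z.2)); last exact: cpsi.
  apply: continuous_pair; last exact: cvg_snd.
  by apply: continuous_comp; [exact: cvg_fst|exact: cf].
have H0 x : f (id x) = H (x, 0) by rewrite /H /= psi0.
have cid : continuous (@id X) by move=> x; exact: cvg_id.
have [L [cL fL L0]] := homotopy_lifting fc cH cid H0.
exists (fun x t => L (x, t)); split; last by move=> x t; rewrite fL.
split=> //.
- by move=> x; apply: continuous_comp; [exact: cf|exact: cp].
- by rewrite (_ : (fun _ => _) = L) //; apply/funext => -[].
(* The group law survives lifting: both sides are lifts in [t] of the same path and start at
   [L (x, s)]. *)
- move=> x s t.
  have cs u : {for u, continuous (fun t : R => L (L (x, s), t))}.
    apply: continuous_comp; last exact: cL.
    by apply: continuous_pair; [exact: cvg_cst|exact: cvg_id].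
  have ct u : {for u, continuous (fun t : R => L (x, s + t))}.
    apply: (@continuous_comp _ _ _ (fun t : R => (x, s + t)) L); last exact: cL.
    apply: continuous_pair; first exact: cvg_cst.
    by apply: cvgD; [exact: cvg_cst|exact: cvg_id].
  apply: (@unique_lifting _ _ _ f setT (fun t => L (L (x, s), t))
    (fun t => L (x, s + t)) 0 t) => //.
  + exact: openT.
  + exact: connected_setTR.
  + by move=> u _; rewrite !fL /H /= fL /H /= psiD.
  + by rewrite addr0 L0.
- by move=> x s t /= px; rewrite fL /H /=; exact: pE.
Qed.

End Flow.

(** * Mapping tori and flows *)

Section UnitInterval.
Variable R : realType.

Lemma unit_intervalP (t : R) : unit_interval R t <-> 0 <= t <= 1.
Proof. by rewrite /unit_interval /= in_itv. Qed.

Lemma clamp_in (u : R) : unit_interval R (Num.max 0 (Num.min u 1)).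
Proof.
by apply/unit_intervalP; rewrite le_max lexx ge_max ler01 ge_min lexx orbT.
Qed.

Definition clamp (u : R) : unit_interval R := insub_set (clamp_in u).

Lemma clampE (u : R) : 0 <= u <= 1 -> set_val (clamp u) = u.
Proof.
by case/andP=> u0 u1; rewrite set_val_insub min_l // max_r.
Qed.

Lemma clampK (t : unit_interval R) : clamp (set_val t) = t.
Proof. apply: set_val_inj; rewrite clampE //.
by apply/unit_intervalP; exact: (set_val_in t). Qed.

Lemma clamp_continuous : continuous clamp.
Proof.
move=> u; apply: continuous_set_val.
apply: (@continuous_max R R (fun=> 0) (fun u => Num.min u 1)).
  exact: cvg_cst.
by apply: (@continuous_min R R id (fun=> 1)); [exact: cvg_id|exact: cvg_cst].
Qed.

End UnitInterval.

Section IntIter.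
Variables (F : topologicalType) (h g : F -> F).
Hypotheses (ch : continuous h) (cg : continuous g).
Hypotheses (hK : cancel h g) (gK : cancel g h).

(** Positive powers iterate [g], the inverse of the monodromy: [(x, 0)] is glued to [(h x, 1)], so
    rising past time 1 from [x] continues at time 0 from [g x]. *)
Definition int_iter (k : int) (x : F) : F :=
  match k with Posz n => iter n g x | Negz n => iter n.+1 h x end.

Lemma int_iterS k x : int_iter (k + 1) x = g (int_iter k x).
Proof.
case: k => [n|[|n]]; first by rewrite -PoszD addn1.
  by rewrite /= hK.
by rewrite (_ : Negz n.+1 + 1 = Negz n) /= ?hK // !NegzE; ring.
Qed.

Lemma int_iterP k x : int_iter (k - 1) x = h (int_iter k x).
Proof. by rewrite -[in RHS](subrK 1 k) int_iterS gK. Qed.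

Lemma int_iterD k l x : int_iter (k + l) x = int_iter k (int_iter l x).
Proof.
elim/int_ind: k => [|n IH|n IH]; first by rewrite add0r.
  by rewrite -addn1 PoszD -addrAC int_iterS IH -int_iterS.
by rewrite -addn1 PoszD opprD -addrAC int_iterP IH -int_iterP.
Qed.

Lemma int_iter_continuous k : continuous (int_iter k).
Proof.
elim/int_ind: k => [|n IH|n IH] x; first exact: cvg_id.
  rewrite (_ : int_iter _ = g \o int_iter n).
    by apply: continuous_comp; [exact: IH|exact: cg].
  by apply/funext => y; rewrite -addn1 PoszD int_iterS.
rewrite (_ : int_iter _ = h \o int_iter (- n%:Z)).
  by apply: continuous_comp; [exact: IH|exact: ch].
by apply/funext => y; rewrite -addn1 PoszD opprD int_iterP.
Qed.

End IntIter.

Lemma continuous_two_pieces (X Y : topologicalType) (f a b : X -> Y) (x : X) :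
  (\forall y \near x, f y = a y \/ f y = b y) -> f x = a x -> f x = b x ->
  {for x, continuous a} -> {for x, continuous b} -> {for x, continuous f}.
Proof.
move=> fab fa fb ca cb U; rewrite /= => Ufx.
have na : \forall y \near x, U (a y) by apply: ca; rewrite -fa.
have nb : \forall y \near x, U (b y) by apply: cb; rewrite -fb.
by apply: filterS3 fab na nb => y [] /= ->.
Qed.

Section Unrolling.
Variables (R : realType) (F M : topologicalType) (h g : F -> F).
Variable q : F * unit_interval R -> M.
Hypotheses (ch : continuous h) (cg : continuous g).
Hypotheses (hK : cancel h g) (gK : cancel g h) (cq : continuous q).
Hypothesis qh : forall x, q (x, clamp 0) = q (h x, clamp 1).

(* [F * R] is the pullback of the mapping torus to the universal cover of the
   circle; [unroll (x, u)] is the point reached from [q (x, 0)] in time [u]. *)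
Definition unroll (z : F * R) : M :=
  q (int_iter h g (Num.floor z.2) z.1, clamp (z.2 - (Num.floor z.2)%:~R)).

Lemma unrollD_int x u (k : int) :
  unroll (x, u + k%:~R) = unroll (int_iter h g k x, u).
Proof.
have fl : Num.floor (u + k%:~R) = Num.floor u + k.
  by rewrite floorDrz ?intrKfloor // intr_int.
rewrite /unroll /= fl int_iterD //; congr (q (_, clamp _)).
by rewrite rmorphD /=; ring.
Qed.

Lemma unroll_unit x (t : unit_interval R) : unroll (x, set_val t) = q (x, t).
Proof.
have /unit_intervalP/andP[t0 t1] := set_val_in t.
rewrite /unroll /=; have [t1'|t1'] := ltP (set_val t) 1.
  have -> : Num.floor (set_val t) = 0 by apply: floor_def; rewrite t0.
  by rewrite subr0 clampK.
have {t1 t1'} t1 : set_val t = 1 by apply/eqP; rewrite eq_le t1.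
have -> : t = clamp 1 by rewrite -t1 clampK.
have f1 : Num.floor (1 : R) = 1 by exact: floor1.
by rewrite clampE ?ler01 ?lexx // f1 subrr /= qh gK.
Qed.

Lemma unroll_continuous : continuous unroll.
Proof.
(* [A k] is the formula for [unroll] on times in [[k, k + 1)], continuous everywhere thanks to
   [clamp]. At a noninteger time one formula applies nearby; at an integer time two of them meet and
   agree by the gluing [qh]. *)
pose A k (z : F * R) := q (int_iter h g k z.1, clamp (z.2 - k%:~R)).
have cA k : continuous (A k).
  move=> z; apply: continuous_comp; last exact: cq.
  apply: continuous_pair.
    apply: continuous_comp; first exact: cvg_fst.
    exact: int_iter_continuous.
  apply: (@continuous_comp _ _ _ (fun z : F * R => z.2 - k%:~R)).
    by apply: cvgB; [exact: cvg_snd|exact: cvg_cst].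
  exact: clamp_continuous.
move=> [x u]; set k := Num.floor u.
have ku : k%:~R <= u by exact: ge_floor.
have uk : u < (k + 1)%:~R by exact: floorD1_gt.
have near2 (a b : R) : a < u -> u < b ->
    \forall z \near (x, u), a < z.2 /\ z.2 < b.
  move=> au ub; have cu : {for (x, u), continuous (@snd F R)} by exact: cvg_snd.
  have na := continuous_near_open cu (@open_gt _ a) au.
  have nb := continuous_near_open cu (@open_lt _ b) ub.
  by apply: filterS2 na nb.
have fl (v : R) l : l%:~R <= v -> v < (l + 1)%:~R -> Num.floor v = l.
  by move=> lv vl; apply: floor_def; rewrite lv.
have [ku'|ku'] := ltP k%:~R u.
  apply: (continuous_near_eq _ (cA k (x, u))).
  apply: filterS (near2 _ _ ku' uk) => -[y v] /= [kv vk].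
  by rewrite /unroll /= (fl v k) // ltW.
have {ku ku'} uE : u = k%:~R by apply/eqP; rewrite eq_le ku'.
apply: (@continuous_two_pieces _ _ _ (A k) (A (k - 1))) => //.
- have k1u : (k - 1)%:~R < u by rewrite uE ltr_int ltrBlDr ltrDl.
  apply: filterS (near2 _ _ k1u uk) => -[y v] /= [kv vk].
  have [kv'|kv'] := leP k%:~R v; [left|right].
    by rewrite /unroll /A /= (fl v k).
  by rewrite /unroll /A /= (fl v (k - 1)) ?subrK // ltW.
- have kk : k%:~R - (k - 1)%:~R = 1 :> R by rewrite -intrB subKr.
  rewrite /unroll /A /= -/k uE subrr kk qh.
  by rewrite -int_iterP // subrK.
- exact: cA.
- exact: cA.
Qed.

End Unrolling.

Section ProductQuotient.
Import ArrowAsCompactOpen.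

(* The real line is locally compact, so by currying [q \times id_R] inherits
   the quotient property of [q]. *)
Lemma continuous_quotient_uncurry (R : realType) (A M Y : topologicalType)
    (q : A -> M) (psi : M -> R -> Y) :
  (forall O, open (q @^-1` O) -> open O) -> (forall m, exists a, q a = m) ->
  continuous (fun z : A * R => psi (q z.1) z.2) ->
  continuous (fun z : M * R => psi z.1 z.2).
Proof.
move=> hq sq cf; have [cc cu] := continuous_curry cf.
have cpsi : continuous (psi : M -> (R -> Y)).
  apply/continuousP => O oO; apply: hq.
  by have /continuousP/(_ O oO) := cc.
have := @continuous_uncurry M R Y psi (@locally_compactR R) (@Rhausdorff R) cpsi.
rewrite (_ : uncurry psi = fun z => psi z.1 z.2); last by apply/funext => -[].
apply=> m; have [a <-] := sq m; exact: cu.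
Qed.

End ProductQuotient.

Section Torus.
Variables (R : realType) (F : topologicalType) (h : F -> F).

Lemma torus_class_continuous :
  continuous (fun z : F * unit_interval R => torus_class h z.1 z.2).
Proof.
rewrite (_ : (fun _ => _) = \pi_(mapping_torus R h)%qT); last first.
  by apply/funext => -[].
exact: pi_continuous.
Qed.

Lemma torus_class_surj (m : mapping_torus R h) :
  exists x t, torus_class h x t = m.
Proof.
exists (repr m).1, (repr m).2.
by rewrite /torus_class -surjective_pairing reprK.
Qed.

Lemma torus_class_open (O : set (mapping_torus R h)) :
  open ((fun z : F * unit_interval R => torus_class h z.1 z.2) @^-1` O) ->
  open O.
Proof.
rewrite (_ : (fun _ => _) = \pi_(mapping_torus R h)%qT) //.
by apply/funext => -[].
Qed.

Lemma torus_class_glue (x : F) :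
  torus_class h x (clamp (0 : R)) = torus_class h (h x) (clamp 1).
Proof.
apply/eqmodP/asboolP; apply: rst_step; split=> //=.
  by rewrite clampE // lexx ler01.
by rewrite clampE // lexx ler01.
Qed.

Lemma torus_class_lift (Z : Type) (k : F * unit_interval R -> Z) :
  (forall x, k (x, clamp 0) = k (h x, clamp 1)) ->
  forall a b, torus_class h a.1 a.2 = torus_class h b.1 b.2 -> k a = k b.
Proof.
move=> kh a b; rewrite /torus_class -!surjective_pairing => /eqmodP/asboolP.
elim=> [[x t] [y u] [/= t0 u1 ->]|//|a' b' _ ->|a' b' c' _ -> _ ->] //.
have -> : t = clamp 0 by rewrite -t0 clampK.
by rewrite kh -u1 clampK.
Qed.

End Torus.

(** Merges the quotient and its identification with [M] into one quotient map [q] with its universal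
    property, so that the quotient type need not be mentioned again on the way to the flow. *)
Lemma surface_bundle_unfold (R : realType) (F M : topologicalType)
    (p : M -> circle R) : surface_bundle F p ->
  exists (h g : F -> F) (q : F * unit_interval R -> M),
    [/\ [/\ continuous h, continuous g, cancel h g & cancel g h],
        [/\ continuous q, forall m, exists a, q a = m,
          forall O, open (q @^-1` O) -> open O &
          forall x, q (x, clamp 0) = q (h x, clamp 1)],
        forall (Z : Type) (k : F * unit_interval R -> Z),
          (forall x, k (x, clamp 0) = k (h x, clamp 1)) ->
          forall a b, q a = q b -> k a = k b &
        forall x t, p (q (x, t)) = expc (set_val t)].
Proof.
case=> _ _ _ [h [[ch [g [cg hK gK]]] [Phi [[cPhi [Psi [cPsi PK KP]]] pE]]]].
pose c (z : F * unit_interval R) := torus_class h z.1 z.2.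
exists h, g, (fun z => Phi (c z)); split=> //.
- split.
  + move=> z; apply: continuous_comp; last exact: cPhi.
    exact: torus_class_continuous.
  + move=> m; have [x [t xt]] := torus_class_surj (Psi m).
    by exists (x, t); rewrite /c /= xt KP.
  + move=> O oO; have -> : O = Psi @^-1` (Phi @^-1` O).
      by apply/seteqP; split=> m /=; rewrite KP.
    by have /continuousP := cPsi; apply; exact: torus_class_open.
  + by move=> x; rewrite /c /= torus_class_glue.
- move=> Z k kh a b /(congr1 Psi); rewrite !PK; exact: torus_class_lift.
- by move=> x t; apply: set_val_inj; rewrite pE set_val_insub.
Qed.

Lemma expc_half_neq0 (R : realType) : expc (1 / 2 : R) <> expc 0.
Proof.
move=> /expc_eqP[k]; rewrite add0r => k2.
have : 0 < (k%:~R : R) < 1 by rewrite -k2; apply/andP; split; lra.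
rewrite -[0]/(0%:~R) -[1]/(1%:~R) !ltr_int; lia.
Qed.

Section BundleToFlow.
Variables (R : realType) (F M : topologicalType) (p : M -> circle R).

Lemma surface_bundle_flow : surface_bundle F p ->
  exists (psi : M -> R -> M) (j : F -> M) (r : M -> F),
    [/\ suspension_flow p psi, continuous j, cancel j r,
        forall y, p y = expc 0 <-> j (r y) = y &
        forall y, j (r y) = y -> {for y, continuous r}].
Proof.
move=> /surface_bundle_unfold[h [g [q [[ch cg hK gK] [cq sq oq qh] qlift pq]]]].
have lift (Z : Type) (k : F * unit_interval R -> Z) :
    (forall x, k (x, clamp 0) = k (h x, clamp 1)) ->
    exists k' : M -> Z, forall a, k' (q a) = k a.
  move=> kh; have [a aP] := choice sq.
  by exists (k \o a) => b /=; apply: qlift => //; rewrite aP.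
pose E := unroll h g q.
have cE : continuous E by exact: unroll_continuous.
have Eh x u : E (h x, u + 1) = E (x, u).
  by rewrite -[1]/(1%:~R) /E unrollD_int //= hK.
have pE x u : p (E (x, u)) = expc u.
  rewrite /E /unroll pq clampE /=; last first.
    by rewrite subr_ge0 ge_floor /= lerBlDr addrC -intrD1 ltW // floorD1_gt.
  by rewrite -mulrNz expcD_int.
have c0 : set_val (clamp (0 : R)) = 0 by rewrite clampE // lexx ler01.
have c1 : set_val (clamp (1 : R)) = 1 by rewrite clampE // lexx ler01.
have h0 : 0 < 1 / 2 :> R by lra.
have h1 : (1 < 1 / 2 :> R) = false by lra.
(* Whole trajectories are descended to the quotient: the two glued points [(x, 0)] and [(h x, 1)]
   have the same one by [Eh]. *)
have [psi psiq] : exists psi : M -> R -> M, forall a,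
    psi (q a) = fun s => E (a.1, set_val a.2 + s).
  apply: (lift _ (fun a => fun s => E (a.1, set_val a.2 + s))) => x.
  by apply/funext => s /=; rewrite c0 c1 [1 + s]addrC Eh add0r.
have psiE x u s : psi (E (x, u)) s = E (x, u + s).
  rewrite {1}/E /unroll psiq /= clampE; last first.
    by rewrite subr_ge0 ge_floor /= lerBlDr addrC -intrD1 ltW // floorD1_gt.
  by rewrite /E -unrollD_int //; congr (unroll _ _ _ (_, _)); ring.
have sE m : exists x u, E (x, u) = m.
  have [[x t] <-] := sq m; exists x, (set_val t); exact: unroll_unit.
(* Cutting the torus at [t = 1/2], away from the fiber over [expc 0], makes the
   retraction [r] continuous along that fiber. *)
have [r rq] : exists r : M -> F, forall a,
    r (q a) = if set_val a.2 < 1 / 2 then a.1 else g a.1.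
  apply: (lift _ (fun a => if set_val a.2 < 1 / 2 then a.1 else g a.1)) => x /=.
  by rewrite c0 c1 h0 h1 hK.
pose j x := q (x, clamp (0 : R)).
have jK : cancel j r.
  by move=> x; rewrite rq /= c0 h0.
have jr y : p y = expc 0 <-> j (r y) = y.
  split=> [|<-]; last by rewrite pq c0.
  have [[x t] <-] := sq y; rewrite pq => /expc_eqP[k]; rewrite add0r => tk.
  have /unit_intervalP := set_val_in t; rewrite tk.
  rewrite -[0]/(0%:~R) -[1]/(1%:~R) !ler_int => k01.
  have [k0|k1] : k = 0 \/ k = 1 by lia.
    by rewrite -(clampK t) tk k0 jK.
  by rewrite -(clampK t) tk k1 -[x in q (x, _)]gK -qh jK.
have hp : continuous p.
  apply/continuousP => O oO; apply: oq.
  have -> : q @^-1` (p @^-1` O) = (fun z => expc (set_val z.2)) @^-1` O.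
    by apply/seteqP; split=> -[x t] /=; rewrite pq.
  suff /continuousP : continuous (fun z : F * unit_interval R => expc (set_val z.2)).
    by apply.
  move=> z; apply: continuous_comp; last exact: expc_continuous.
  apply: continuous_comp; first exact: cvg_snd.
  exact: set_val_continuous.
exists psi, j, r; split=> //.
- split=> //.
  + apply: (continuous_quotient_uncurry oq sq).
    rewrite (_ : (fun _ => _) = E \o
      (fun z : (F * unit_interval R) * R => (z.1.1, set_val z.1.2 + z.2))); last first.
      by apply/funext => z /=; rewrite psiq.
    move=> z; apply: continuous_comp; last exact: cE.
    have cf : continuous (fun z : (F * unit_interval R) * R => z.1).
      by move=> ?; exact: cvg_fst.
    apply: continuous_pair.
      by apply: continuous_comp; [exact: cf|exact: cvg_fst].
    apply: cvgD; last exact: cvg_snd.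
    apply: (@continuous_comp _ _ _ (fun z : (F * unit_interval R) * R => z.1.2)).
      by apply: continuous_comp; [exact: cf|exact: cvg_snd].
    exact: set_val_continuous.
  + by move=> m; have [x [u <-]] := sE m; rewrite psiE addr0.
  + by move=> m s t; have [x [u <-]] := sE m; rewrite !psiE addrA.
  + move=> m s t; have [x [u <-]] := sE m; rewrite psiE !pE.
    by move=> /expc_eqP[k ->]; apply/expc_eqP; exists k; ring.
- move=> x; apply: (@continuous_comp _ _ _ (fun x => (x, clamp (0 : R)))).
    by apply: continuous_pair; [exact: cvg_id|exact: cvg_cst].
  exact: cq.
- move=> y /jr py V; rewrite /= nbhsE => -[V' [oV' V'y] V'V].
  (* Removing the fiber over [expc (1 / 2)], where [r] jumps, leaves two open halves upstairs; on
     each of them [r \o q] is a single continuous formula. *)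
  pose O := [set m | V' (r m) /\ p m <> expc (1 / 2)].
  suff oO : open O.
    have : nbhs y O.
      apply: open_nbhs_nbhs; split=> //; split=> //.
      by rewrite py; apply/nesym; exact: expc_half_neq0.
    by apply: filterS => m [/V'V].
  apply: oq.
  have cs : continuous (fun z : F * unit_interval R => set_val z.2).
    move=> z; apply: continuous_comp; first exact: cvg_snd.
    exact: set_val_continuous.
  have pz (z : F * unit_interval R) : p (q z) <> expc (1 / 2) <->
      set_val z.2 < 1 / 2 \/ 1 / 2 < set_val z.2.
    case: z => x t /=; rewrite pq; split; last first.
      move=> th /expc_eqP[k tk]; have /unit_intervalP := set_val_in t.
      have -> : set_val t = 1 / 2 + k%:~R by [].
      move=> /andP[t0 t1].
      have : - 1 < (k%:~R : R) < 1 by apply/andP; split; lra.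
      rewrite -[1]/(1%:~R) -mulrNz !ltr_int => k0.
      have {k0} k0 : k = 0 by lia.
      by move: th; rewrite tk k0 addr0 ltxx => -[].
    move=> th; case: (ltgtP (set_val t) (1 / 2)) => [||tE]; [by left|by right|].
    by move: th; rewrite tE.
  rewrite (_ : q @^-1` O = ((fun z => set_val z.2) @^-1` [set u | u < 1 / 2] `&`
      (fun z : F * unit_interval R => z.1) @^-1` V') `|`
     ((fun z => set_val z.2) @^-1` [set u | 1 / 2 < u] `&`
      (fun z : F * unit_interval R => g z.1) @^-1` V')); last first.
    apply/seteqP; split=> z; rewrite /O /= ?pz rq.
      by case=> + [zl|zl]; [rewrite zl|rewrite ltNge ltW //=]; [left|right].
    by case=> -[zl Vz]; [rewrite zl|rewrite ltNge ltW //=]; split=> //; [left|right].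
  have co (f : F * unit_interval R -> F) : continuous f -> open (f @^-1` V').
    by move=> /continuousP; exact.
  have cr (f : F * unit_interval R -> R) B :
      continuous f -> open B -> open (f @^-1` B).
    by move=> /continuousP cf oB; exact: cf.
  apply: openU; apply: openI.
  + by apply: cr => //; exact: open_lt.
  + by apply: co => z; exact: cvg_fst.
  + by apply: cr => //; exact: open_gt.
  + apply: co => z; apply: continuous_comp; first exact: cvg_fst.
    exact: cg.
Qed.

End BundleToFlow.

Section FlowToBundle.
Variables (R : realType) (X : topologicalType) (p : X -> circle R).
Variable psi : X -> R -> X.
Hypothesis flow : suspension_flow p psi.

Local Notation Ft := (set_type (fiber p (expc 0))).

Lemma flow_surface_bundle : surface R Ft -> [set: Ft] !=set0 ->
  connected [set: Ft] -> surface_bundle Ft p.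
Proof.
case: flow => cp cpsi psi0 psiD pE sF F0 cF; split=> //.
have pF (x : Ft) : p (set_val x) = expc 0 by exact: (set_val_in x).
have fib (x : Ft) (k : int) : fiber p (expc 0) (psi (set_val x) k%:~R).
  by rewrite /fiber /= (pE _ _ 0) // expcD_int.
(* The monodromy is the return map at time -1: the gluing demands that [h x], flowed for time 1, be
   [x]. *)
pose h (x : Ft) : Ft := insub_set (fib x (- 1)).
pose g (x : Ft) : Ft := insub_set (fib x 1).
have hK : cancel h g.
  by move=> x; apply: set_val_inj; rewrite !set_val_insub psiD mulrNz addNr psi0.
have gK : cancel g h.
  by move=> x; apply: set_val_inj; rewrite !set_val_insub psiD mulrNz subrr psi0.
have cfib (k : int) : continuous (fun x : Ft => psi (set_val x) k%:~R).
  move=> x; have ck := @cst_continuous Ft R (k%:~R) x.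
  exact: (continuous_comp2 cpsi (@set_val_continuous _ _ x) ck).
have ch : continuous h by move=> x; apply: continuous_set_val; exact: cfib.
have cg : continuous g by move=> x; apply: continuous_set_val; exact: cfib.
pose c (z : Ft * unit_interval R) := torus_class h z.1 z.2.
have cc : continuous c by exact: torus_class_continuous.
have cglue x : c (x, clamp 0) = c (h x, clamp 1) by exact: torus_class_glue.
pose k0 (z : Ft * unit_interval R) := psi (set_val z.1) (set_val z.2).
have k0h x : k0 (x, clamp 0) = k0 (h x, clamp 1).
  rewrite /k0 /= !clampE ?lexx ?ler01 // set_val_insub psiD mulrNz addNr.
  by [].
pose Phi (m : mapping_torus R h) : X := k0 (repr m).
have PhiE z : Phi (c z) = k0 z.
  apply: (torus_class_lift k0h); rewrite /c /torus_class -!surjective_pairing.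
  by rewrite reprK.
have cPhi : continuous Phi.
  apply/quotient_continuous; rewrite (_ : _ \o _ = k0); last first.
    by apply/funext => -[x t]; rewrite -PhiE.
  move=> z; apply: (continuous_comp2 (a := fun z => set_val z.1)
    (b := fun z => set_val z.2) cpsi).
    by apply: continuous_comp; [exact: cvg_fst|exact: set_val_continuous].
  by apply: continuous_comp; [exact: cvg_snd|exact: set_val_continuous].
have iterE k x : set_val (int_iter h g k x) = psi (set_val x) k%:~R.
  elim/int_ind: k => [|n IH|n IH]; first by rewrite /= psi0.
    by rewrite -addn1 PoszD int_iterS // set_val_insub IH psiD -intrD.
  rewrite -addn1 PoszD opprD int_iterP // set_val_insub IH psiD -intrD //.
pose E := unroll h g c.
have cE : continuous E by exact: unroll_continuous.
have PE x u : Phi (E (x, u)) = psi (set_val x) u.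
  have uf : 0 <= u - (Num.floor u)%:~R <= 1.
    by rewrite subr_ge0 ge_floor /= lerBlDr addrC -intrD1 ltW // floorD1_gt.
  rewrite /E /unroll PhiE /k0 /= iterE psiD clampE //; congr (psi _ _).
  by rewrite addrC subrK.
(* The inverse flows [y] back to the fiber by any of its angles [u]; a change of [u] by an integer
   is absorbed by [unrollD_int]. Having the formula for every [u] allows a locally continuous angle
   to be inserted later. *)
have [Psi PsiE] : exists Psi : X -> mapping_torus R h, forall y u (x : Ft),
    p y = expc u -> set_val x = psi y (- u) -> Psi y = E (x, u).
  have /choice[v vP] := fun y => expc_surj (p y).
  have fv y : fiber p (expc 0) (psi y (- v y)).
    by rewrite /fiber /= (pE _ _ _ (vP y)) subrr.
  exists (fun y => E (insub_set (fv y), v y)) => y u x pu xu.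
  have [k vk] : exists k : int, v y = u + k%:~R by apply/expc_eqP; rewrite -vP.
  have := set_val_insub (fv y); move: (insub_set _) => x' x'E.
  rewrite vk /E unrollD_int //; congr (unroll _ _ _ (_, _)).
  apply: set_val_inj; rewrite iterE x'E psiD xu vk.
  by congr psi; ring.
have PsiK y : Phi (Psi y) = y.
  have [u yu] := expc_surj (p y).
  have fu : fiber p (expc 0) (psi y (- u)).
    by rewrite /fiber /= (pE _ _ _ yu) subrr.
  by rewrite (PsiE y u (insub_set fu)) // PE set_val_insub psiD addNr psi0.
have PhiK m : Psi (Phi m) = m.
  have [x [t <-]] := torus_class_surj m.
  rewrite -[torus_class _ _ _]/(c (x, t)) PhiE.
  rewrite (PsiE _ (set_val t) x).
  - exact: unroll_unit.
  - by rewrite /k0 /= (pE _ _ 0) // add0r.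
  - by rewrite /k0 /= psiD subrr psi0.
have cPsi : continuous Psi.
  move=> y0; have [t0 y0t] := expc_surj (p y0).
  have [U [th [[oU Uy0] th0 cth thE]]] := expc_local_section t0.
  rewrite -y0t in Uy0.
  have [x0 _] := F0.
  pose w y := psi y (- th (p y)).
  (* [x0] is a default for [y] outside the domain of the local angle [th]; near [y0] the value is
     [w y]. *)
  pose W y : Ft := if pselect (fiber p (expc 0) (w y)) is left e
    then insub_set e else x0.
  have wF y : U (p y) -> fiber p (expc 0) (w y).
    by move=> Uy; rewrite /fiber /= (pE _ _ (th (p y))) ?subrr // thE.
  have WE y : U (p y) -> set_val (W y) = w y.
    by move=> Uy; rewrite /W; case: pselect => // /(_ (wF y Uy)).
  have nU : \forall y \near y0, U (p y) by exact: (continuous_near_open (cp y0) oU Uy0).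
  apply: (@continuous_near_eq _ _ (fun y => E (W y, th (p y)))).
    apply: filterS nU => y Uy; rewrite (PsiE y (th (p y)) (W y)) ?thE //.
    exact: WE.
  have ct : {for y0, continuous (th \o p)}.
    by apply: continuous_comp; [exact: cp|exact: cth].
  apply: (@continuous_comp _ _ _ (fun y => (W y, th (p y)))); last exact: cE.
  apply: continuous_pair; last exact: ct.
  apply: continuous_set_val.
  apply: (@continuous_near_eq _ _ w).
    by apply: filterS nU => y Uy; rewrite /= WE.
  apply: (continuous_comp2 (a := id) (b := fun y => - th (p y)) cpsi).
    exact: cvg_id.
  by apply: cvgN; exact: ct.
exists h; split; first by split=> //; exists g.
exists Phi; split; first by split=> //; exists Psi.
move=> x t; rewrite -[torus_class _ _ _]/(c (x, t)) PhiE /k0 /= (pE _ _ 0) //.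
by rewrite add0r.
Qed.

End FlowToBundle.

(** * An equivariant root of the projection to the circle *)

(** Nonempty clopen sets are compared by their number of points over [x0]. If [B] is properly
    contained in [A], then the nonempty clopen set [A] minus [B] also meets the fiber over [x0], so
    the count drops strictly. *)
Lemma minimal_clopen (X F : topologicalType) (f : X -> F) (x0 : F) :
  finite_cover f -> connected [set: F] -> [set: X] !=set0 ->
  exists A : set X, [/\ clopen A, A !=set0 &
    forall B, clopen B -> B !=set0 -> B `<=` A -> B = A].
Proof.
move=> fc cF X0; case: (fc) => _ tr.
have [k [U [s [[oU Ux0] [fs so sc si]]]]] := tr x0.
pose c (B : set X) := #|[pred i : 'I_k | `[< B (s i x0) >]]|.
have hit B : clopen B -> B !=set0 -> exists i, B (s i x0).
  move=> [oB cB] B0; have [b [Bb fb]] := finite_cover_clopen_surj x0 fc cF oB cB B0.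
  by have [|i sib] := sc b; [rewrite fb|exists i; rewrite -fb sib].
have ex : exists n, `[< exists B, [/\ clopen B, B !=set0 & c B = n] >].
  by exists (c setT); apply/asboolP; exists setT; split=> //; exact: clopenT.
case: (ex_minnP ex) => n /asboolP[A [clA A0 cA]] nmin; exists A.
split=> // B clB B0 BA.
apply: contrapT => nBA.
have clD : clopen (A `\` B).
  move: clA clB => [oA cA'] [oB cB]; rewrite setDE.
  by split; [apply: openI => //; exact: closed_openC|
    apply: closedI => //; exact: open_closedC].
have [i [Ai nBi]] : exists i, (A `\` B) (s i x0).
  apply: hit => //; apply/set0P/eqP => AB0; apply: nBA; apply/seteqP; split=> //.
  by rewrite -setD_eq0.
have : (n <= c B)%N by apply: nmin; apply/asboolP; exists B.
rewrite -cA leqNgt => /negP; apply; apply: proper_card; apply/properP; split.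
  by apply/fintype.subsetP => j /asboolP Bj; apply/asboolP; exact: (BA _ Bj).
by exists i; [apply/asboolP|apply/asboolPn].
Qed.

Lemma connected_minimal_clopen (X : topologicalType) (A : set X) : clopen A ->
  (forall B, clopen B -> B !=set0 -> B `<=` A -> B = A) -> connected A.
Proof.
move=> [oA cA] Amin B B0 [C oC BC] [D cD BD]; apply: Amin => //.
  by split; [rewrite BC; exact: openI|rewrite BD; exact: closedI].
by rewrite BC => x [].
Qed.

Section CircleRoot.
Variables (R : realType) (X F : topologicalType) (p : X -> circle R).
Variable psi : X -> R -> X.
Hypothesis flow : suspension_flow p psi.
Local Notation P0 := (set_type (fiber p (expc 0))).

(** A flow box around [y0]: nearby points have a continuous angle and flow back into the open part
    [G] of the fiber. It yields both the openness of reachability conditions and the continuity of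
    the root. *)
Lemma near_slice (G : set P0) (y0 : X) (u0 : R) : open G -> p y0 = expc u0 ->
  (exists a : P0, G a /\ set_val a = psi y0 (- u0)) ->
  exists u : X -> R, [/\ {for y0, continuous u}, u y0 = u0 &
    \forall y \near y0, p y = expc (u y) /\
      exists a : P0, G a /\ set_val a = psi y (- u y)].
Proof.
case: flow => cp cpsi psi0 psiD pE [V oV VG] pu0 [a0 [Ga0 a0E]].
have [U [th [[oU Uy0] th0 cth thE]]] := expc_local_section u0.
rewrite -pu0 in Uy0; exists (th \o p).
have cu : {for y0, continuous (th \o p)}.
  by apply: continuous_comp; [exact: cp|exact: cth].
split=> //=; first by rewrite pu0.
have cu' : {for y0, continuous (fun y => - th (p y))} by apply: cvgN; exact: cu.
have cw := continuous_comp2 cpsi (@cvg_id _ (nbhs y0)) cu'.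
have nV : \forall y \near y0, V (psi y (- th (p y))).
  apply: (continuous_near_open cw) => //=.
  have : (set_val @^-1` V) a0 by rewrite VG.
  by rewrite /= a0E pu0 th0.
have nU := continuous_near_open (cp y0) oU Uy0.
apply: filterS2 nU nV => y Uy Vy; rewrite thE //; split=> //.
have fy : fiber p (expc 0) (psi y (- th (p y))).
  by rewrite /fiber /= (pE _ _ (th (p y))) ?subrr // thE.
by exists (insub_set fy); rewrite -VG.
Qed.

Lemma circle_root (f : P0 -> F) (x0 : F) : finite_cover f ->
  connected [set: F] -> connected [set: X] -> [set: X] !=set0 ->
  exists (m : nat) (pt : X -> circle R),
    [/\ (0 < m)%N, suspension_flow pt (fun x s => psi x (m%:R * s)),
        forall x t, pt x = expc t -> p x = expc (m%:R * t) &
        connected (fiber pt (expc 0)) /\ fiber pt (expc 0) !=set0].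
Proof.
move=> fc cF cX [y1 _]; case: flow => cp cpsi psi0 psiD pE.
have pP (a : P0) : p (set_val a) = expc 0 by exact: (set_val_in a).
have P00 : [set: P0] !=set0.
  have [t1 y1t] := expc_surj (p y1).
  have fy : fiber p (expc 0) (psi y1 (- t1)).
    by rewrite /fiber /= (pE _ _ _ y1t) subrr.
  by exists (insub_set fy).
have [A [clA [a0 Aa0] Amin]] := minimal_clopen x0 fc cF P00.
have fT (k : int) (a : P0) : fiber p (expc 0) (psi (set_val a) k%:~R).
  by rewrite /fiber /= (pE _ _ 0) // expcD_int.
pose T k a : P0 := insub_set (fT k a).
have TE k a : set_val (T k a) = psi (set_val a) k%:~R by [].
have TD k l a : T k (T l a) = T (k + l) a.
  by apply: set_val_inj; rewrite !TE psiD intrD addrC.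
have T0 a : T 0 a = a by apply: set_val_inj; rewrite TE psi0.
have cT k : continuous (T k).
  move=> a; apply: continuous_set_val.
  exact: (continuous_comp2 cpsi (@set_val_continuous _ _ a)
    (@cst_continuous P0 R (k%:~R) a)).
have clT k (B : set P0) : clopen B -> clopen (T k @^-1` B).
  by move=> clB; apply: (clopen_comp _ (cT k)).
(* The return times of [A]; minimality of [A] makes them a subgroup of Z. *)
pose S k := exists a, A a /\ A (T k a).
have SA k : S k -> forall a, A a -> A (T k a).
  move=> [a [Aa ATa]]; have AE : A `&` T k @^-1` A = A.
    by apply: Amin; [apply: clopenI => //; exact: clT|exists a|move=> ? []].
  by move=> b; rewrite -{1}AE => -[].
have SD k l : S k -> S l -> S (k + l).
  move=> Sk Sl; exists a0; split=> //; rewrite -TD.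
  by apply: (SA k Sk); exact: (SA l Sl).
have SN k : S k -> S (- k).
  by move=> Sk; exists (T k a0); split; [exact: SA|rewrite TD addNr T0].
have SM k (l : int) : S k -> S (l * k).
  move=> Sk; elim/int_ind: l => [|l IH|l IH].
  - by rewrite mul0r; exists a0; split=> //; rewrite T0.
  - by rewrite -addn1 PoszD mulrDl mul1r; exact: SD.
  - by rewrite -addn1 PoszD opprD mulrDl mulN1r; apply: SD => //; exact: SN.
have exS : exists n : nat, (0 < n)%N && `[< S n%:Z >].
  case: (fc) => _ tr; have [K [U [s [[oU Ux0] [fs so sc si]]]]] := tr x0.
  (* Pigeonhole: each of the [K + 1] translates of [A] contains one of the [K] points over [x0], so
     two translates share a point and the difference of their indices is a return time. *)
  have hit (i : 'I_K.+1) : exists j : 'I_K, A (T (- (i : nat)%:Z) (s j x0)).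
    have [oB cB] : clopen (T (- (i : nat)%:Z) @^-1` A) by exact: clT.
    have [|b [Bb fb]] := finite_cover_clopen_surj x0 fc cF oB cB.
      by exists (T (i : nat)%:Z a0); rewrite /= TD addNr T0.
    by have [|j sjb] := sc b; [rewrite fb|exists j; rewrite -fb sjb].
  have [sg sgP] := choice hit.
  have /injectivePn[i [i' ii' sgi]] : ~~ injectiveb sg.
    by apply/injectiveP => /leq_card; rewrite !card_ord ltnn.
  wlog ltii : i i' ii' sgi / (i < i')%N.
    move=> H; case: (ltngtP i i') => [|gt|eq]; first exact: H.
      by apply: (H i' i) => //; rewrite eq_sym.
    by move: ii'; rewrite -val_eqE /= eq eqxx.
  exists (i' - i)%N; rewrite subn_gt0 ltii /=; apply/asboolP.
  rewrite -[Posz _]opprK; apply: SN; exists (T (- (i : nat)%:Z) (s (sg i) x0)).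
  split; first exact: sgP.
  rewrite TD (_ : _ + _ = - (i' : nat)%:Z); last first.
    by lia.
  by rewrite sgi; exact: sgP.
case: (ex_minnP exS) => m /andP[m0 /asboolP Sm] mmin.
have m0R : m%:R != 0 :> R by rewrite pnatr_eq0 -lt0n.
have Sdvd k : S k -> exists l : int, k = l * m%:Z.
  move=> Sk; exists (k %/ m%:Z)%Z.
  have kE := divz_eq k m%:Z.
  have r0 : (0 <= k %% m%:Z)%Z by rewrite modz_ge0 // eqz_nat -lt0n.
  have rm : ((k %% m%:Z)%Z < m%:Z) by rewrite ltz_pmod.
  have Sr : S (k %% m%:Z)%Z.
    rewrite (_ : (k %% m%:Z)%Z = k + (- (k %/ m%:Z)%Z) * m%:Z); last first.
      by rewrite {2}kE; ring.
    by apply: SD => //; exact: SM.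
  rewrite [LHS]kE; move: r0 rm Sr; case: (k %% m%:Z)%Z => // r _ rm Sr.
  have -> : r = 0%N; last by rewrite addr0.
  apply/eqP; rewrite -leqn0 leqNgt; apply/negP => r1.
  suff : (m <= r)%N by rewrite leqNgt -ltz_nat rm.
  by apply: mmin; rewrite r1; apply/asboolP.
(* [D y u]: the point [y] is reached from [A] in time [u]. *)
pose D y u := p y = expc u /\ exists a, A a /\ set_val a = psi y (- u).
have oA : open A by case: clA.
have Dshift y u u' : D y u -> p y = expc u' ->
    exists k : int, u' = u + k%:~R /\ forall a : P0, set_val a = psi y (- u') ->
      exists b, A b /\ a = T (- k) b.
  move=> [yu [b [Ab bE]]] yu'.
  have [k uk] : exists k : int, u' = u + k%:~R by apply/expc_eqP; rewrite -yu'.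
  exists k; split=> // a aE; exists b; split=> //; apply: set_val_inj.
  by rewrite TE aE bE psiD uk mulrNz opprD.
(* Two times differ by an integer since both are angles of [p y]; this integer is a return time of
   [A], hence a multiple of [m]. *)
have Duniq y u u' : D y u -> D y u' -> exists l : int, u' = u + m%:R * l%:~R.
  move=> Du [yu' [a [Aa aE]]]; have [k [uk kP]] := Dshift y u u' Du yu'.
  have [b [Ab ab]] := kP a aE.
  have [l kl] : exists l : int, k = l * m%:Z.
    by apply: Sdvd; rewrite -[k]opprK; apply: SN; exists b; rewrite -ab.
  by exists l; rewrite uk kl intrM mulrC.
have Dex y : exists u, D y u.
  apply: (@connected_locally_constant _ (fun y => exists u, D y u) (set_val a0)) => //.
    move=> z; have [[u [zu aP]]|nD] := pselect (exists u, D z u).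
      have [w [_ _ nw]] := near_slice oA zu aP.
      by apply: filterS nw => z' Dz'; split=> _; [exists u|exists (w z')].
    have [u zu] := expc_surj (p z).
    (* For an unreachable [z], the point of the fiber it flows back to lies in [B]. Openness of [B]
       is a finite matter: multiples of [m] preserve [A], so only the translates by [0, ..., m - 1]
       count. *)
    pose B := [set a : P0 | forall k, ~ A (T k a)].
    have oB : open B.
      rewrite openE => a Ba.
      have : \forall b \near a, forall i : 'I_m, ~ A (T (i : nat)%:Z b).
        apply: (@near_forall P0) => i.
        by apply: (continuous_near_open (cT _ a) (closed_openC clA.2)); exact: Ba.
      apply: filterS => b Bb k ATk.
      have r0 : (0 <= k %% m%:Z)%Z by rewrite modz_ge0 // eqz_nat -lt0n.
      have rm : ((k %% m%:Z)%Z < m%:Z) by rewrite ltz_pmod.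
      have kE := divz_eq k m%:Z.
      have : A (T (k %% m%:Z)%Z b).
        rewrite (_ : (k %% m%:Z)%Z = (- (k %/ m%:Z)%Z) * m%:Z + k); last first.
          by rewrite {3}kE; ring.
        by rewrite -TD; apply: SA => //; exact: SM.
      case: (k %% m%:Z)%Z r0 rm => // r _ rm.
      exact: (Bb (Ordinal (rm : (r < m)%N))).
    have fz : fiber p (expc 0) (psi z (- u)).
      by rewrite /fiber /= (pE _ _ _ zu) subrr.
    have [|w [_ _ nw]] := near_slice oB zu.
      exists (insub_set fz); split=> // k ATk; apply: nD; exists (u - k%:~R).
      split; first by rewrite -mulrNz expcD_int.
      exists (T k (insub_set fz)); split=> //.
      by rewrite TE set_val_insub psiD opprB addrC.
    apply: filterS nw => z' [z'w [a [Ba aE]]]; split=> [[v Dv]|//].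
    have [k [_ kP]] := Dshift z' v _ Dv z'w.
    have [b [Ab ab]] := kP a aE; exfalso.
    by apply: (Ba k); rewrite ab TD subrr T0.
  by exists 0; split; [exact: pP|exists a0; rewrite oppr0 psi0].
have [u uP] := choice Dex.
(* The chosen time [u y] need not be continuous, but it is determined modulo [m], so [u y / m] is
   determined modulo 1. *)
pose pt y : circle R := expc (u y / m%:R).
have ptE y v : D y v -> pt y = expc (v / m%:R).
  move=> Dv; rewrite /pt; have [l ->] := Duniq _ _ _ Dv (uP y).
  by rewrite mulrDl mulrAC divff // mul1r expcD_int.
exists m, pt; split=> //.
- split.
  + move=> y0; have [yu aP] := uP y0.
    have [w [cw wy0 nw]] := near_slice oA yu aP.
    apply: (@continuous_near_eq _ _ (fun y => expc (w y / m%:R))).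
      by apply: filterS nw => y Dy; rewrite (ptE _ (w y)).
    apply: (@continuous_comp _ _ _ (fun y => w y / m%:R)); last exact: expc_continuous.
    by apply: cvgM; [exact: cw|exact: cvg_cst].
  + move=> z; apply: (continuous_comp2 cpsi (@cvg_fst _ _ _ _ _)).
    by apply: cvgM; [exact: cvg_cst|exact: cvg_snd].
  + by move=> x; rewrite mulr0 psi0.
  + by move=> x s t; rewrite psiD mulrDr.
  + move=> x s t ptx; have [xu [a [Aa aE]]] := uP x.
    have := ptx; rewrite (ptE x (u x)) // => /expc_eqP[k uk].
    rewrite (ptE _ (u x + m%:R * s)); last first.
      split; first by rewrite (pE _ _ _ xu).
      by exists a; rewrite psiD opprD addrCA addrN addr0.
    by apply/expc_eqP; exists k; rewrite mulrDl uk mulrAC divff // mul1r; ring.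
- move=> x t; rewrite (ptE x (u x)) // => /expc_eqP[k uk].
  have [-> _] := uP x; apply/expc_eqP; exists (m%:Z * k).
  by rewrite intrM -[u x](divfK m0R) uk; ring.
(* The fiber of the root over [expc 0] is [A] itself, and a minimal clopen set is connected. *)
have fibE : fiber pt (expc 0) = set_val @` A.
  apply/seteqP; split=> [y|_ [a Aa <-]].
    rewrite /fiber /= (ptE y (u y)) // => /expc_eqP[k]; rewrite add0r => uk.
    have [yu [a [Aa aE]]] := uP y.
    exists (T (k * m%:Z) a); first by apply: SA => //; exact: SM.
    rewrite TE aE psiD intrM -uk divfK // addNr psi0 //.
  rewrite /fiber /= (ptE _ 0) ?mul0r //.
  by split; [exact: pP|exists a; rewrite oppr0 psi0].
split; rewrite fibE; last by exists (set_val a0), a0.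
apply: connected_continuous_connected; first exact: connected_minimal_clopen.
by apply: continuous_subspaceT => a; exact: set_val_continuous.
Qed.

End CircleRoot.

(** * The intermediate bundle *)

Lemma continuous_into_hausdorff (X Y : topologicalType) (f : X -> Y) :
  continuous f -> injective f -> hausdorff_space Y -> hausdorff_space X.
Proof.
rewrite !open_hausdorff => /continuousP cf fi hY x y xy.
have [|[A B] /= [xA yB] [oA oB AB]] := hY (f x) (f y).
  by apply: contraNneq xy => /fi ->.
exists (f @^-1` A, f @^-1` B) => /=; first by move: xA yB; rewrite !inE.
split; [exact: cf|exact: cf|].
by rewrite -preimage_setI (eqP AB) preimage_set0.
Qed.

Lemma circle_hausdorff (R : realType) : hausdorff_space (circle R).
Proof.
apply: (continuous_into_hausdorff (@set_val_continuous _ _)).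
  exact: set_val_inj.
exact: (@norm_hausdorff R (R * R)%type).
Qed.

Lemma near_neq (X Y : topologicalType) (f g : X -> Y) (x : X) :
  hausdorff_space Y -> {for x, continuous f} -> {for x, continuous g} ->
  f x <> g x -> \forall y \near x, f y <> g y.
Proof.
rewrite open_hausdorff => hY cf cg /eqP fg.
have [[A B] /= [xA yB] [oA oB /eqP AB]] := hY _ _ fg.
rewrite !inE in xA yB.
have nA := continuous_near_open cf oA xA; have nB := continuous_near_open cg oB yB.
apply: filterS2 nA nB => y Ay By fgy.
have : (A `&` B) (f y) by split=> //; rewrite fgy.
by rewrite AB.
Qed.

(** * Powers, rotations and roots on the circle *)

Section CirclePower.
Variable R : realType.

(** The chosen angle [v] jumps somewhere, but periodicity lets the local section [th] replace it
    near any given point. The parameter space [Z] accommodates the rotations. *)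
Lemma circle_descent (Z W : topologicalType) (K : R -> Z -> W) :
  continuous (fun z : R * Z => K z.1 z.2) ->
  (forall t (k : int) z, K (t + k%:~R) z = K t z) ->
  exists K' : circle R -> Z -> W, continuous (fun z => K' z.1 z.2) /\
    forall t z, K' (expc t) z = K t z.
Proof.
move=> cK Kper; have [v vP] := choice (@expc_surj R).
have K'E t z : K (v (expc t)) z = K t z.
  by have /esym/expc_eqP[k ->] := vP (expc t); rewrite Kper.
exists (fun c z => K (v c) z); split=> // -[c0 z0].
have [t0 ct0] := expc_surj c0.
have [U [th [[oU Uc] th0 cth thE]]] := expc_local_section t0.
rewrite -ct0 in Uc.
have c1 : {for (c0, z0), continuous (@fst (circle R) Z)} by exact: cvg_fst.
have c2 : {for (c0, z0), continuous (@snd (circle R) Z)} by exact: cvg_snd.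
have nU := continuous_near_open c1 oU Uc.
apply: (@continuous_near_eq _ _ (fun z => K (th z.1) z.2)).
  by apply: filterS nU => -[c z] /= Uz; rewrite -{2}(thE _ Uz) K'E.
have ct : {for (c0, z0), continuous (fun z : circle R * Z => th z.1)}.
  exact: (continuous_comp c1 (cth _ Uc)).
exact: (continuous_comp2 cK ct c2).
Qed.

Lemma circle_power (m : nat) : exists pw : circle R -> circle R,
  continuous pw /\ forall t, pw (expc t) = expc (m%:R * t).
Proof.
(* The power map has no parameter; a dummy real one is supplied and then set to 0. *)
have [||pw [cpw pwE]] := @circle_descent R (circle R) (fun t _ => expc (m%:R * t)).
- move=> z; apply: (@continuous_comp _ _ _ (fun z : R * R => m%:R * z.1)).
    by apply: cvgM; [exact: cvg_cst|exact: cvg_fst].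
  exact: expc_continuous.
- by move=> t k _; apply/expc_eqP; exists (m%:Z * k); rewrite intrM; ring.
exists (fun c => pw c 0); split=> // c.
exact: (continuous_comp2 cpw (@cvg_id _ _) (@cst_continuous _ R 0 c)).
Qed.

Lemma circle_rotation : exists rot : circle R -> R -> circle R,
  continuous (fun z => rot z.1 z.2) /\
  forall t s, rot (expc t) s = expc (t + s).
Proof.
apply: (circle_descent (K := fun t s => expc (t + s))).
  move=> z; apply: (@continuous_comp _ _ _ (fun z : R * R => z.1 + z.2)).
    by apply: cvgD; [exact: cvg_fst|exact: cvg_snd].
  exact: expc_continuous.
by move=> t k s; apply/expc_eqP; exists k; ring.
Qed.

Variables (m : nat) (m0 : (0 < m)%N).

Lemma expc_root (t v : R) : expc (m%:R * v) = expc t ->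
  exists i : 'I_m, expc v = expc ((t + (i : nat)%:R) / m%:R).
Proof.
have m0R : m%:R != 0 :> R by rewrite pnatr_eq0 -lt0n.
move=> /expc_eqP[k vk].
have r0 : (0 <= k %% m%:Z)%Z by rewrite modz_ge0 // eqz_nat -lt0n.
have rm : ((k %% m%:Z)%Z < m%:Z) by rewrite ltz_pmod.
have kE := divz_eq k m%:Z.
move: r0 rm kE; case: (k %% m%:Z)%Z => // r _ rm kE.
exists (Ordinal (rm : (r < m)%N)) => /=.
apply/expc_eqP; exists (k %/ m%:Z)%Z.
have kR : k%:~R = (k %/ m%:Z)%Z%:~R * m%:R + r%:R :> R.
  by rewrite {1}kE intrD intrM.
apply: (mulfI m0R); rewrite vk mulrDr [m%:R * (_ / _)]mulrC divfK // kR.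
by ring.
Qed.

Lemma expc_root_inj (t : R) (i j : 'I_m) :
  expc ((t + (i : nat)%:R) / m%:R) = expc ((t + (j : nat)%:R) / m%:R) -> i = j.
Proof.
have m0R : m%:R != 0 :> R by rewrite pnatr_eq0 -lt0n.
move=> /expc_eqP[k /(congr1 (fun x => x * m%:R))].
rewrite divfK // mulrDl divfK // => ijk.
have : (i : nat)%:Z = (j : nat)%:Z + k * m%:Z.
  by apply: (@intr_inj R); rewrite intrD intrM; move: ijk; lra.
have := ltn_ord i; have := ltn_ord j => jm im ij; apply: val_inj => /=.
have k0 : k = 0 by nia.
by move: ij; rewrite k0 mul0r addr0 => -[].
Qed.

Lemma expcM_root (t : R) (i : 'I_m) :
  expc (m%:R * ((t + (i : nat)%:R) / m%:R)) = expc t.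
Proof.
have m0R : m%:R != 0 :> R by rewrite pnatr_eq0 -lt0n.
by rewrite mulrC divfK // (expcD_int _ (i : nat)%:Z).
Qed.

End CirclePower.

(** The sheets of [g] near [a0] are the sheets [s i] of [q \o g] with [g (s i (q a0)) = a0]: both
    [g \o s i \o q] and the identity lift [q] through [q], so near [a0] they agree if and only if
    they agree at [a0]. *)
Lemma finite_cover_factor (X N M : topologicalType) (g : X -> N) (q : N -> M) :
  finite_cover (q \o g) -> finite_cover q -> continuous g -> finite_cover g.
Proof.
move=> [_ tr] fq cg; case: (fq) => cq _; split=> // a0.
have [k [U [s [[oU Ua0] [fs so sc si]]]]] := tr (q a0).
have nU : \forall a \near a0, U (q a) by exact: (continuous_near_open (cq a0) oU Ua0).
have nS : \forall a \near a0, forall i, g (s i (q a)) = a <-> g (s i (q a0)) = a0.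
  apply: near_forall => i; apply: (lifts_near_eq fq).
  - have cs := continuous_comp (cq a0) (fs i _ Ua0).2.
    exact: (continuous_comp cs (cg _)).
  - exact: cvg_id.
  - by apply: filterS nU => a Ua; exact: (fs i _ Ua).1.
have : nbhs a0 [set a | U (q a) /\
    forall i, g (s i (q a)) = a <-> g (s i (q a0)) = a0].
  by apply: filterS2 nU nS.
rewrite nbhsE => -[W oWa0 WP].
pose J := [pred i : 'I_k | `[< g (s i (q a0)) = a0 >]].
exists #|J|, W, (fun i => s (enum_val i) \o q); split=> //.
have JP (i : 'I_#|J|) : g (s (enum_val i) (q a0)) = a0.
  by apply/asboolP; exact: (enum_valP i).
split.
- move=> i a /WP[Ua ga]; split; first exact/ga.
  exact: (continuous_comp (cq a) (fs _ _ Ua).2).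
- move=> i; case: oWa0 => oW _.
  rewrite (_ : [set _ | _] = [set x | U (q (g x)) /\ s (enum_val i) (q (g x)) = x]
      `&` g @^-1` W).
    by apply: openI => //; move/continuousP: cg; exact.
  by apply/seteqP; split=> x /= => [[/[dup] /WP[]]|[[]]].
- move=> x Wx; have [Ux gx] := WP _ Wx; have [i six] := sc x Ux.
  have Ji : i \in J by apply/asboolP/gx; rewrite [s i _]six.
  by exists (enum_rank_in Ji i) => /=; rewrite enum_rankK_in.
- by move=> a i j /WP[Ua _] sij; apply: enum_val_inj; exact: si sij.
Qed.

(** Pulling back this one-sheeted covering turns an embedded copy of [F] into a covering of [F],
    through which the surface structure is transported. *)
Lemma finite_cover_id (X : topologicalType) : finite_cover (@id X).
Proof.
split=> [x|y]; first exact: cvg_id.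
exists 1%N, setT, (fun _ => id); split; first by split=> //; exact: openT.
split=> //.
- by move=> i x _; split=> //; exact: cvg_id.
- move=> i; rewrite (_ : [set x : X | [set: X] x /\ x = x] = setT).
    exact: openT.
  by apply/seteqP; split.
- by move=> x _; exists ord0.
- by move=> x i j _ _; rewrite !ord1.
Qed.

Lemma card_finType (T : finType) : ([set: T] #= `I_#|T|)%card.
Proof.
apply: (@card_eq_trans _ _ _ _ [set: 'I_#|T|]); last first.
  by rewrite card_eq_sym; exact: card_II.
rewrite card_eq_sym (_ : setT = enum_rank @` [set: T]).
  by apply: inj_card_eq => x y _ _; exact: enum_rank_inj.
by apply/seteqP; split=> // i _; exists (enum_val i) => //; exact: enum_valK.
Qed.

Lemma fold_covering_comp (X N M : topologicalType) (g : X -> N) (q : N -> M)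
    (n m k : nat) (y : M) : fold_covering n (q \o g) -> fold_covering m q ->
  fold_covering k g -> n = (m * k)%N.
Proof.
move=> [_ fn] [_ fm] [_ fk].
have [a [ai aE]] := card_ordP (fm y).
have /choice[b bP] := fun i => card_ordP (fk (a i)).
have ba i j : g (b i j) = a i.
  have [_ bE] := bP i; have : range (b i) (b i j) by exists j.
  by rewrite bE.
have bi : injective (fun ij : 'I_m * 'I_k => b ij.1 ij.2).
  move=> [i j] [i' j'] /= bb.
  have ii' : i = i' by apply: ai; rewrite -(ba i j) -(ba i' j') bb.
  by subst i'; congr pair; exact: (bP i).1.
apply/card_eq_II; apply: (@card_eq_trans _ _ _ _ ((q \o g) @^-1` [set y])).
  by rewrite card_eq_sym.
rewrite (_ : _ @^-1` _ = (fun ij : 'I_m * 'I_k => b ij.1 ij.2) @` setT).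
  apply: (@card_eq_trans _ _ _ _ [set: 'I_m * 'I_k]).
    by apply: inj_card_eq => x x' _ _; exact: bi.
  by have := card_finType ('I_m * 'I_k)%type; rewrite card_prod !card_ord.
apply/seteqP; split=> [x /= qgx|_ [[i j] _ <-]] /=.
  have : range a (g x) by rewrite aE.
  case=> i _ aig; have : range (b i) x by rewrite (bP i).2 /= aig.
  by case=> j _ bx; exists (i, j).
have : range a (a i) by exists i.
by rewrite aE ba.
Qed.

Lemma connected_set_type (X : topologicalType) (A : set X) :
  connected A -> connected [set: A].
Proof.
move=> cA B [b Bb] [C oC BC] [D cD BD]; rewrite !setTI in BC BD.
case: (oC) => O oO OC; have [V oV VD] := closed_openC cD.
have BE x (Ax : A x) : B (insub_set Ax) <-> O x by rewrite BC -OC.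
have BE' x (Ax : A x) : B (insub_set Ax) <-> ~ V x.
  split; first by rewrite BD => Dx Vx; have : (~` D) (insub_set Ax) by rewrite -VD.
  move=> nV; rewrite BD; apply: contrapT => nD.
  by apply: nV; have : (~` D) (insub_set Ax) by []; rewrite -VD.
have VA : set_val @` B = A.
  apply: cA; first by exists (set_val b), b.
    exists O => //; apply/seteqP; split=> [_ [x Bx <-]|x [Ax Ox]].
      split; first exact: set_val_in.
      apply/(BE _ (set_val_in x)).
      by rewrite (_ : insub_set _ = x) //; exact: set_val_inj.
    by exists (insub_set Ax) => //; exact/BE.
  exists (~` V); first exact: open_closedC.
  apply/seteqP; split=> [_ [x Bx <-]|x [Ax Ox]].
    split; first exact: set_val_in.
    apply/(BE' _ (set_val_in x)).
    by rewrite (_ : insub_set _ = x) //; exact: set_val_inj.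
  by exists (insub_set Ax) => //; exact/BE'.
apply/seteqP; split=> // x _; have : (set_val @` B) (set_val x).
  by rewrite VA; exact: set_val_in.
by case=> y By /set_val_inj <-.
Qed.

(** Trajectories are connected and all of them meet the fiber over [expc 0]. This gives the
    connectedness of the intermediate bundle. *)
Lemma flow_connected (R : realType) (X : topologicalType) (p : X -> circle R)
    (psi : X -> R -> X) : suspension_flow p psi ->
  connected [set: set_type (fiber p (expc 0))] -> connected [set: X].
Proof.
move=> [cp cpsi psi0 psiD pE] cF B [b Bb] [C oC BC] [D cD BD].
rewrite !setTI in BC BD; rewrite -BC in oC; rewrite -BD in cD.
have locB x : \forall y \near x, B y <-> B x.
  have [Bx|nBx] := pselect (B x).
    have : nbhs x B by exact: open_nbhs_nbhs.
    by apply: filterS => y By; split.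
  have : nbhs x (~` B) by apply: open_nbhs_nbhs; split=> //; exact: closed_openC.
  by apply: filterS => y By; split.
have pull (T : topologicalType) (f : T -> X) (x y : T) : connected [set: T] ->
    continuous f -> B (f x) -> B (f y).
  move=> cT cf; apply: (@connected_locally_constant _ (B \o f) x y cT) => z.
  exact: (cf z _ (locB (f z))).
have Bflow x s t : B (psi x s) -> B (psi x t).
  apply: (pull R (psi x)); first exact: connected_setTR.
  move=> u; exact: (continuous_comp2 cpsi (@cst_continuous _ X x u) (@cvg_id _ _)).
have toF x : exists u (a : set_type (fiber p (expc 0))), set_val a = psi x u.
  have [u xu] := expc_surj (p x); exists (- u).
  have fx : fiber p (expc 0) (psi x (- u)) by rewrite /fiber /= (pE _ _ _ xu) subrr.
  by exists (insub_set fx).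
apply/seteqP; split=> // x _.
have [u [a aE]] := toF x; have [v [c cE]] := toF b.
have Bc : B (set_val c) by rewrite cE; apply: (Bflow b 0); rewrite psi0.
rewrite -(psi0 x); apply: (Bflow x u); rewrite -aE.
exact: (pull _ _ c a cF (@set_val_continuous _ _)).
Qed.

(** * The pullback of a bundle along the [m]-th power map *)

Section FiberProduct.
Variables (R : realType) (M : topologicalType) (p : M -> circle R) (m : nat).
Variable pw : circle R -> circle R.
Hypotheses (m0 : (0 < m)%N) (cp : continuous p).
Hypothesis pwE : forall t, pw (expc t) = expc (m%:R * t).

Definition fiber_product : set (M * circle R) := [set z | p z.1 = pw z.2].

Local Notation N := (set_type fiber_product).

Definition fiber_product_fst (a : N) : M := (set_val a).1.
Definition fiber_product_snd (a : N) : circle R := (set_val a).2.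
Local Notation q := fiber_product_fst.
Local Notation pN := fiber_product_snd.

Lemma fiber_productE (a : N) : p (q a) = pw (pN a).
Proof. exact: (set_val_in a). Qed.

Lemma fiber_product_inj (a b : N) : q a = q b -> pN a = pN b -> a = b.
Proof.
move=> qab pab; apply: set_val_inj.
by rewrite [LHS]surjective_pairing [RHS]surjective_pairing; congr pair.
Qed.

Lemma fiber_product_fst_continuous : continuous q.
Proof.
by move=> a; apply: continuous_comp; [exact: set_val_continuous|exact: cvg_fst].
Qed.

Lemma fiber_product_snd_continuous : continuous pN.
Proof.
by move=> a; apply: continuous_comp; [exact: set_val_continuous|exact: cvg_snd].
Qed.

Lemma fiber_product_fst_fold : fold_covering m q.
Proof.
have cq := fiber_product_fst_continuous; have cN := fiber_product_snd_continuous.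
apply: trivialized_fold_covering => // x0.
have [t0 x0t] := expc_surj (p x0).
have [U [th [[oU Uc] th0 cth thE]]] := expc_local_section t0.
rewrite -x0t in Uc.
(* With a local angle [th] for [p x], the [m] roots of [p x] become continuous functions of [x];
   they are the sheets. *)
pose w (i : 'I_m) x := expc ((th (p x) + (i : nat)%:R) / m%:R).
have Nw i x : U (p x) -> fiber_product (x, w i x).
  by move=> Ux; rewrite /fiber_product /= pwE expcM_root ?thE.
pose s i x : N := if pselect (U (p x)) is left Ux then insub_set (Nw i x Ux)
  else insub_set (Nw i x0 Uc).
have sE i x : U (p x) -> set_val (s i x) = (x, w i x).
  by rewrite /s; case: pselect.
have oU' : open (p @^-1` U) by move/continuousP: cp; exact.
have cw i x : U (p x) -> {for x, continuous (w i)}.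
  move=> Ux; apply: (@continuous_comp _ _ _
    (fun x => (th (p x) + (i : nat)%:R) / m%:R)); last exact: expc_continuous.
  have ct := continuous_comp (@cp x) (cth _ Ux).
  by apply: cvgM; [apply: cvgD; [exact: ct|exact: cvg_cst]|exact: cvg_cst].
have sP i a : U (p (q a)) -> s i (q a) = a <-> pN a = w i (q a).
  move=> Ua; split=> [<-|aw]; first by rewrite /q /pN sE.
  by apply: fiber_product_inj; rewrite /q /pN sE.
have sex a : U (p (q a)) -> exists i, pN a = w i (q a).
  move=> Ua; have [v av] := expc_surj (pN a).
  have [i vi] : exists i : 'I_m, expc v = expc ((th (p (q a)) + (i : nat)%:R) / m%:R).
    by apply: expc_root => //; rewrite -pwE -av -fiber_productE thE.
  by exists i; rewrite av vi.
have winj x i j : w i x = w j x -> i = j by exact: expc_root_inj.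
exists (p @^-1` U), s; split; first by split.
split.
- move=> i x Ux; split; first by rewrite /q sE.
  apply: continuous_set_val.
  apply: (@continuous_near_eq _ _ (fun x => (x, w i x))).
    have : \forall y \near x, (p @^-1` U) y by exact: open_nbhs_nbhs.
    by apply: filterS => y Uy; rewrite /= sE.
  by apply: continuous_pair; [exact: cvg_id|exact: cw].
- move=> i; rewrite openE => a [Ua /(sP _ _ Ua) aw].
  have nU : \forall b \near a, U (p (q b)).
    exact: (continuous_near_open (cq a) oU' Ua).
  (* A sheet is open because nearby points avoid the other finitely many roots, the circle being
     Hausdorff, while by [sex] they lie at some root. *)
  have nw : \forall b \near a, forall j, j != i -> pN b <> w j (q b).
    apply: (@near_forall N) => j.
    have [->|ji] := eqVneq j i; first exact: (@near_all N).
    have cj : {for a, continuous (w j \o q)}.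
      exact: (continuous_comp (cq a) (cw j _ Ua)).
    have ne : pN a <> (w j \o q) a.
      by move=> awj; move/eqP: ji; apply; apply: (winj (q a)); rewrite -aw.
    by apply: filterS (near_neq (@circle_hausdorff R) (cN a) cj ne).
  apply: filterS2 nU nw => b Ub bw; split=> //; apply/(sP _ _ Ub).
  have [j bj] := sex b Ub; have [<-//|ji] := eqVneq j i.
  by have := bw j ji.
- by move=> a Ua; have [i ai] := sex a Ua; exists i; apply/(sP _ _ Ua).
- move=> x i j Ux /(congr1 (fun z => set_val z)); rewrite !sE // => /(congr1 snd).
  exact: (winj x).
Qed.

(** [M] moves at speed [m] while the circle coordinate turns at speed 1; the power map multiplies
    angles by [m], so the defining equation is preserved. *)
Lemma fiber_product_flow (psi : M -> R -> M) : suspension_flow p psi ->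
  exists psiN : N -> R -> N, suspension_flow pN psiN.
Proof.
move=> [_ cpsi psi0 psiD pE]; have [rot [crot rotE]] := circle_rotation R.
have NP (a : N) s : fiber_product (psi (q a) (m%:R * s), rot (pN a) s).
  have [v av] := expc_surj (pN a).
  rewrite /fiber_product /= av rotE pwE (pE _ _ (m%:R * v)) ?mulrDr //.
  by rewrite fiber_productE av pwE.
exists (fun a s => insub_set (NP a s)); split.
- exact: fiber_product_snd_continuous.
- move=> z; apply: continuous_set_val; apply: continuous_pair.
    have c1 : {for z, continuous (fun z : N * R => q z.1)}.
      by apply: continuous_comp; [exact: cvg_fst|exact: fiber_product_fst_continuous].
    have c2 : {for z, continuous (fun z : N * R => m%:R * z.2)}.
      by apply: cvgM; [exact: cvg_cst|exact: cvg_snd].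
    exact: (continuous_comp2 cpsi c1 c2).
  have c1 : {for z, continuous (fun z : N * R => pN z.1)}.
    by apply: continuous_comp; [exact: cvg_fst|exact: fiber_product_snd_continuous].
  have c2 : {for z, continuous (fun z : N * R => z.2)} by exact: cvg_snd.
  exact: (continuous_comp2 crot c1 c2).
- move=> a; apply: fiber_product_inj.
    by rewrite {1}/q set_val_insub /= mulr0 psi0.
  rewrite {1}/pN set_val_insub /=.
  by have [v ->] := expc_surj (pN a); rewrite rotE addr0.
- move=> a s t; apply: fiber_product_inj.
    by rewrite {1}/q [in RHS]/q !set_val_insub /= {1}/q set_val_insub /= psiD mulrDr.
  rewrite {1}/pN [in RHS]/pN !set_val_insub /= {1}/pN set_val_insub /=.
  rewrite -/(fiber_product_snd a).
  by have [v ->] := expc_surj (pN a); rewrite !rotE addrA.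
- by move=> a s t at_; rewrite {1}/pN set_val_insub /= at_ rotE.
Qed.

Lemma fiber_product_fibers (z : circle R) : exists Fi : 'I_m -> set N,
  disjoint_union Fi (q @^-1` fiber p z) /\
  forall i : 'I_m, restricts_to_homeo q (Fi i) (fiber p z).
Proof.
have cq := fiber_product_fst_continuous; have cN := fiber_product_snd_continuous.
have [t zt] := expc_surj z.
pose w (i : 'I_m) := expc ((t + (i : nat)%:R) / m%:R).
have winj i j : w i = w j -> i = j by exact: expc_root_inj.
(* The pieces are separated by which of the [m] roots of [z] the circle coordinate equals. *)
exists (fun i => [set a | p (q a) = z /\ pN a = w i]); split.
  split.
  - by move=> i j _ _ [a [[_ ai] [_ aj]]]; apply: winj; rewrite -ai.
  - apply/seteqP; split=> [a [i _ []] //|a az].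
    have [v av] := expc_surj (pN a).
    have [i vi] : exists i : 'I_m, expc v = expc ((t + (i : nat)%:R) / m%:R).
      by apply: expc_root => //; rewrite -pwE -av -fiber_productE -zt.
    by exists i => //; split=> //; rewrite av vi.
  (* The separating open set is given by avoidance of the other roots, since over [z] this forces
     the [i]-th one. *)
  - move=> i; exists [set a | forall j, j != i -> pN a <> w j]; split.
      rewrite openE => a aw; apply: (@near_forall N) => j.
      have [->|ji] := eqVneq j i; first exact: (@near_all N).
      have := near_neq (@circle_hausdorff R) (cN a)
        (@cst_continuous N _ (w j) a) (aw j ji).
      by apply: filterS.
    apply/seteqP; split=> a /= [az aw]; split=> //.
      by move=> j ji awj; move/eqP: ji; apply; apply: winj; rewrite -aw.
    have [v av] := expc_surj (pN a).
    have [j vj] : exists j : 'I_m, expc v = expc ((t + (j : nat)%:R) / m%:R).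
      by apply: expc_root => //; rewrite -pwE -av -fiber_productE -zt.
    have awj : pN a = w j by rewrite av vj.
    by have [<-//|ji] := eqVneq j i; have := aw j ji.
move=> i; pose Fi := [set a : N | p (q a) = z /\ pN a = w i].
have fP (a : Fi) : fiber p z (q (set_val a)) by exact: (set_val_in a).1.
have NP (x : fiber p z) : fiber_product (set_val x, w i).
  rewrite /fiber_product /= pwE expcM_root // -zt; exact: (set_val_in x).
have FP (x : fiber p z) : Fi (insub_set (NP x)).
  by split=> //; exact: (set_val_in x).
exists (fun a => insub_set (fP a)); split=> //; split.
  move=> a; apply: continuous_set_val.
  exact: (continuous_comp (@set_val_continuous _ _ a) (cq _)).
exists (fun x => insub_set (FP x)); split.
- move=> x; do 2 apply: continuous_set_val.
  exact: (continuous_pair (@set_val_continuous _ _ x)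
    (@cst_continuous _ _ (w i) x)).
- move=> a; apply: set_val_inj; apply: fiber_product_inj => //.
  by rewrite (set_val_in a).2.
- by move=> x; apply: set_val_inj.
Qed.

End FiberProduct.

Theorem corollary2p3 (R : realType) (F M : topologicalType)
    (p : M -> circle R) (hM : surface_bundle F p)
    (n : nat) (hn : (0 < n)%N)
    (Mt : topologicalType) (hMt : connected [set: Mt])
    (phi : Mt -> M) (hphi : fold_covering n phi) :
  exists (m : nat)
         (Ft : topologicalType) (pt : Mt -> circle R)
         (N FN : topologicalType) (pN : N -> circle R)
         (phi_g : Mt -> N) (phi_q : N -> M),
    [/\ (m %| n)%N, surface_bundle Ft pt & surface_bundle FN pN] /\
    [/\ bundle_covering (n %/ m)%N pt pN phi_g,
        bundle_covering m pN p phi_q &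
        phi = phi_q \o phi_g] /\
    (forall z : circle R, exists Fi : 'I_m -> set N,
        disjoint_union Fi (phi_q @^-1` fiber p z) /\
        forall i : 'I_m, restricts_to_homeo phi_q (Fi i) (fiber p z)) /\
    (forall z : circle R, connected (phi_g @^-1` fiber pN z)).
Proof.
have [psi [j [r [flow cj jK pj cr]]]] := surface_bundle_flow hM.
case: (hM) => sF [x0 _] cF _.
have fphi := fold_covering_finite_cover hphi.
have [psit [flowt phipsi]] := flow_lift fphi flow.
have ftP y : fiber (p \o phi) (expc 0) y <-> j (r (phi y)) = phi y by exact: pj.
have fcP := finite_cover_pullback fphi cj jK ftP cr.
(* Since [0 < n], there is a point over [j x0]. *)
have Mt0 : [set: Mt] !=set0.
  have [g [_ gE]] := card_ordP (hphi.2 (j x0)).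
  by exists (g (Ordinal hn)).
have [m [pt [m0 flowm ptp [cFt Ft0]]]] := circle_root flowt x0 fcP cF hMt Mt0.
have [pw [cpw pwE]] := circle_power R m.
have cp : continuous p by case: flow.
have cpt : continuous pt by case: flowm.
have cphi : continuous phi := fphi.1.
pose N := set_type (fiber_product p pw).
pose q : N -> M := @fiber_product_fst R M p pw.
pose pN : N -> circle R := @fiber_product_snd R M p pw.
have cq : continuous q by exact: fiber_product_fst_continuous.
have cpN : continuous pN by exact: fiber_product_snd_continuous.
have qfold : fold_covering m q by exact: fiber_product_fst_fold.
have [psiN flowN] := fiber_product_flow pwE flow.
have Ng y : fiber_product p pw (phi y, pt y).
  by have [t yt] := expc_surj (pt y); rewrite /fiber_product /= yt pwE; exact: ptp.
pose g y : N := insub_set (Ng y).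
have cg : continuous g.
  move=> y; apply: continuous_set_val.
  by apply: continuous_pair; [exact: cphi|exact: cpt].
have gfc : finite_cover g.
  exact: (@finite_cover_factor Mt N M g q fphi (fold_covering_finite_cover qfold) cg).
have Nj x : fiber_product p pw (j x, expc 0).
  by rewrite /fiber_product /= pwE mulr0; apply/pj; rewrite jK.
(* The power map fixes [expc 0], so the fiber of [N] over [expc 0] is a copy of [F], embedded by
   [jN] with inverse [rN]. *)
pose jN x : N := insub_set (Nj x).
pose rN a : F := r (q a).
have cjN : continuous jN.
  move=> x; apply: continuous_set_val.
  by apply: continuous_pair; [exact: cj|exact: cvg_cst].
have jNK : cancel jN rN by move=> x; rewrite /rN /q /fiber_product_fst /= jK.
have jNP a : fiber pN (expc 0) a <-> jN (rN a) = a.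
  split=> [a0|<-//]; apply: fiber_product_inj; last exact/esym.
  rewrite {1}/fiber_product_fst /=; apply/pj.
  by rewrite fiber_productE [X in pw X]a0 pwE mulr0.
have crN a : jN (rN a) = a -> {for a, continuous rN}.
  move=> ja; have jra : j (r (q a)) = q a by rewrite -{2}ja.
  exact: (continuous_comp (cq a) (cr _ jra)).
have surfN : surface R (set_type (fiber pN (expc 0))).
  have fc := finite_cover_pullback (finite_cover_id N) cjN jNK jNP crN.
  exact: finite_cover_surface fc sF.
have surft : surface R (set_type (fiber pt (expc 0))).
  have gP y : fiber pt (expc 0) y <-> jN (rN (g y)) = g y by rewrite -jNP.
  have fc := finite_cover_pullback gfc cjN jNK gP crN.
  exact: finite_cover_surface fc sF.
have fN x : fiber pN (expc 0) (jN x) by [].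
have cFN : connected [set: set_type (fiber pN (expc 0))].
  rewrite (_ : setT = (fun x => insub_set (fN x)) @` [set: F]).
    apply: connected_continuous_connected => //; apply: continuous_subspaceT => x.
    by apply: continuous_set_val; exact: cjN.
  apply/seteqP; split=> // a _; exists (rN (set_val a)) => //.
  by apply: set_val_inj; apply/jNP; exact: set_val_in.
have cN : connected [set: N] by exact: flow_connected flowN cFN.
(* Connectedness of [N] gives [g] a constant degree [k], identified as [n / m] by counting the
   points over [j x0]. *)
have [k gk] := finite_cover_fold (jN x0) cN gfc.
have nmk : n = (m * k)%N.
  exact: (@fold_covering_comp Mt N M g q n m k (j x0) hphi qfold gk).
exists m, (set_type (fiber pt (expc 0))), pt, N,
  (set_type (fiber pN (expc 0))), pN, g, q.
split; [split|split; [split|split]].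
- by rewrite nmk dvdn_mulr.
- apply: (flow_surface_bundle flowm surft); last exact: connected_set_type.
  by case: Ft0 => y Fy; exists (insub_set Fy).
- by apply: (flow_surface_bundle flowN surfN) => //; exists (insub_set (fN x0)).
(* The base map of [g] is the identity: [pN (g y)] computes to [pt y]. *)
- rewrite nmk mulKn //; split=> //; exists id; split=> // z; exact: cvg_id.
- by split=> //; exists pw; split=> // a; exact: fiber_productE.
- by [].
- exact: fiber_product_fibers.
- move=> z; have [t ->] := expc_surj z; case: (flowm) => _ _ psi0 psiD ptE.
  (* The preimage is the fiber of [pt] over [expc t], which the flow carries from the connected
     fiber over [expc 0]. *)
  rewrite (_ : g @^-1` fiber pN (expc t) =
      (fun y => psit y (m%:R * t)) @` fiber pt (expc 0)).
    apply: connected_continuous_connected => //; apply: continuous_subspaceT => y.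
    exact: (flow_continuous (t := t) flowm).
  apply/seteqP; split=> [y /= yt|_ [y /= y0 <-]]; last first.
    by rewrite /fiber /=; have := ptE y t 0 y0; rewrite add0r.
  exists (psit y (m%:R * - t)).
    by rewrite /fiber /= (ptE _ _ t yt) subrr.
  by rewrite psiD addNr psi0.
Qed.
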